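(* There exists a one-parameter family $(\mathcal{P}_x)_{x\in J}$ of packings of $\mathbb{R}^3$ by congruent regular tetrahedra such that, for every $x\in J$, the following hold. (1) $\mathcal{P}_x$ is periodic and has packing fraction $100/117$. (2) Each primitive unit cell of the lattice $\Lambda_x$ of translations of $\mathcal{P}_x$ contains two bipyramidal dimers: the tetrahedra of $\mathcal{P}_x$ can be partitioned into bipyramidal dimers so that $\Lambda_x$ permutes the dimers and has exactly two orbits of dimers, with each unit cell containing one representative of each orbit (thus four tetrahedra per unit cell). (3) The group of all isometries of $\mathbb{R}^3$ leaving $\mathcal{P}_x$ invariant is a crystallographic space group of type $C2/c$, and it acts transitively on the individual tetrahedra of $\mathcal{P}_x$.
   Context: A packing by congruent regular tetrahedra is a collection $\mathcal{P}$ of solid regular tetrahedra in $\mathbb{R}^3$, all congruent to one another, with pairwise disjoint interiors (tetrahedra may touch along their boundaries). An isometry $g$ of $\mathbb{R}^3$ leaves $\mathcal{P}$ invariant if $T\mapsto g(T)$ is a bijection of $\mathcal{P}$ onto itself. The packing is periodic if the set $\Lambda$ of vectors $v\in\mathbb{R}^3$ such that translation by $v$ leaves $\mathcal{P}$ invariant is a lattice of rank 3 and $\Lambda$ has finitely many orbits on $\mathcal{P}$. Then $\Lambda$ is called the lattice of translations of $\mathcal{P}$, and the phrase ''a unit cell contains $N$ tetrahedra'' (or $N$ dimers) means that there are exactly $N$ orbits of tetrahedra (or dimers) under $\Lambda$, with ''unit cell'' meaning primitive unit cell. The packing fraction of a periodic packing with $N$ tetrahedra per primitive unit cell, each of volume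 $V$, is $NV/\operatorname{covol}(\Lambda)$, where $\operatorname{covol}(\Lambda)$ is the absolute value of the determinant of a basis of $\Lambda$. A bipyramidal dimer is the union of two congruent regular tetrahedra that share a common (full) face and lie on opposite sides of it. A one-parameter family of packings means a family indexed by a real parameter $x$ ranging over an interval $J\subset\mathbb{R}$ of positive length, with packings for distinct values of the parameter not congruent to each other. A space group of type $C2/c$ (number 15 in the International Tables) is a group of isometries of $\mathbb{R}^3$ that is conjugate, by an orientation-preserving affine bijection of $\mathbb{R}^3$, to the group generated by the translations by $(1,0,0)$, $(0,1,0)$, $(0,0,1)$ and $(\tfrac12,\tfrac12,0)$, the map $(u,v,w)\mapsto(-u,v,-w+\tfrac12)$, and the inversion $(u,v,w)\mapsto(-u,-v,-w)$. *)

(* Defs.v *)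
(* Points of Euclidean 3-space are row vectors of type 'rV[R]_3. *)
From HB Require Import structures.
From mathcomp Require Export all_boot all_order all_algebra.
From mathcomp Require Export all_classical all_reals all_analysis.
Set Implicit Arguments.
Unset Strict Implicit.
Unset Printing Implicit Defensive.
Import Order.TTheory GRing.Theory Num.Theory.
Import numFieldNormedType.Exports.
Local Open Scope classical_set_scope.
Local Open Scope ring_scope.
Local Open Scope card_scope.

Section Packings.
Variable R : realType.
Local Notation V := 'rV[R]_3.
Implicit Types (T : set V) (P D : set (set V)) (L : set V) (g : V -> V).

Definition vec3 (a b c : R) : V := \row_(i < 3) [:: a; b; c]`_i.

(* The library norm on 'rV[R]_3 is the sup norm, so the Euclidean structure is
   introduced here; the topology (hence [interior]) is the same for both. *)
Definition dot (u v : V) : R := \sum_(i < 3) u 0 i * v 0 i.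
Definition edist (u v : V) : R := Num.sqrt (dot (u - v) (u - v)).

(* Distance-preserving self-maps of R^3 are automatically bijective. *)
Definition is_isometry g : Prop := forall u v, edist (g u) (g v) = edist u v.

Definition congruent T T' : Prop := exists2 g, is_isometry g & g @` T = T'.

Definition congruent_packings P P' : Prop :=
  exists2 g, is_isometry g & [set g @` T | T in P] = P'.

(* Lebesgue measure of R^3, through the identification of R^3 with
   (R * R) * R. *)
Definition volume T : \bar R :=
  (((@lebesgue_measure R) \x (@lebesgue_measure R)) \x (@lebesgue_measure R))%E
    [set p | T (vec3 p.1.1 p.1.2 p.2)].

Definition conv4 (p : 'I_4 -> V) : set V :=
  [set u | exists w : 'I_4 -> R,
     [/\ forall i, 0 <= w i, \sum_i w i = 1 & u = \sum_i w i *: p i]].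

Definition regular_vertices (p : 'I_4 -> V) : Prop :=
  exists2 l : R, 0 < l & forall i j, i != j -> edist (p i) (p j) = l.

Definition regular_tetrahedron T : Prop :=
  exists2 p, regular_vertices p & T = conv4 p.

Definition tetrahedron_packing P : Prop :=
  [/\ forall T, P T -> regular_tetrahedron T,
      forall T T', P T -> P T' -> congruent T T' &
      forall T T', P T -> P T' -> T <> T' -> interior T `&` interior T' = set0].

Definition leaves_invariant g P : Prop := set_bij P P (fun T => g @` T).

Definition translation (v : V) : V -> V := fun u => u + v.

Definition translations P : set V :=
  [set v | leaves_invariant (translation v) P].

(* The rows of B are a basis of the rank 3 lattice L. *)
Definition lattice_basis L (B : 'M[R]_3) : Prop :=
  B \in unitmx /\ L = [set v | exists z : 'rV[int]_3, v = map_mx intr z *m B].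

Definition orbits L P : set (set (set V)) :=
  [set [set translation v @` T | v in L] | T in P].

Definition periodic P : Prop :=
  (exists B, lattice_basis (translations P) B) /\
  finite_set (orbits (translations P) P).

Definition per_unit_cell P D (N : nat) : Prop :=
  orbits (translations P) D #= `I_N.

Definition has_packing_fraction P (phi : R) : Prop :=
  exists (B : 'M[R]_3) (N : nat) (vol : R),
    [/\ lattice_basis (translations P) B,
        per_unit_cell P P N,
        forall T, P T -> volume T = vol%:E &
        phi = N%:R * vol / `|\det B| ].

(* T1 and T2 share the face opposite to their vertex of index ord_max; the
   vector n is normal to the plane of that face, and its sign on the two
   remaining vertices says that they lie strictly on opposite sides. *)
Definition dimer_halves T1 T2 : Prop :=
  exists p q : 'I_4 -> V,
    [/\ [/\ regular_vertices p, regular_vertices q, T1 = conv4 p &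
            T2 = conv4 q],
        congruent T1 T2,
        forall i, i != ord_max -> p i = q i &
        exists n : V,
          [/\ forall i, i != ord_max -> dot n (p i - p ord0) = 0,
              0 < dot n (p ord_max - p ord0) &
              dot n (q ord_max - p ord0) < 0]].

Definition dimer_partition P D : Prop :=
  (forall X, D X -> exists T1 T2,
     [/\ P T1, P T2, dimer_halves T1 T2 & X = T1 `|` T2]) /\
  (forall T, P T -> exists! X, D X /\ T `<=` X).

Definition symmetries P : set (V -> V) :=
  [set g | is_isometry g /\ leaves_invariant g P].

Inductive generated (S : set (V -> V)) : (V -> V) -> Prop :=
| gen_id : generated S id
| gen_mem g : S g -> generated S g
| gen_comp g h : generated S g -> generated S h -> generated S (g \o h)
| gen_inv g h : generated S g -> cancel g h -> cancel h g -> generated S h.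

Definition C2c_generators : set (V -> V) :=
  [set translation (vec3 1 0 0); translation (vec3 0 1 0);
       translation (vec3 0 0 1); translation (vec3 2^-1 2^-1 0);
       (fun u : V => vec3 (- u 0 0) (u 0 1) (- u 0 2%:R + 2^-1));
       (fun u : V => - u)].

Definition affine_map (A : 'M[R]_3) (b : V) : V -> V := fun u => u *m A + b.
Definition affine_inv (A : 'M[R]_3) (b : V) : V -> V :=
  fun u => (u - b) *m invmx A.

Definition space_group_C2c (G : set (V -> V)) : Prop :=
  (forall g, G g -> is_isometry g) /\
  exists (A : 'M[R]_3) (b : V), 0 < \det A /\
    G = [set affine_map A b \o h \o affine_inv A b
        | h in generated C2c_generators].

Definition transitive_on (G : set (V -> V)) P : Prop :=
  forall T T', P T -> P T' -> exists2 g, G g & g @` T = T'.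

(* One-parameter family of packings by congruent regular tetrahedra.  The
   tetrahedra are congruent across the whole family, so that rescaling a single
   packing does not count as varying the parameter. *)
Definition one_parameter_family (J : set R) (P : R -> set (set V)) : Prop :=
  [/\ is_interval J /\ (exists a b, [/\ J a, J b & a < b]),
      forall x, J x -> tetrahedron_packing (P x),
      forall x y T T', J x -> J y -> P x T -> P y T' -> congruent T T' &
      forall x y, J x -> J y -> x <> y -> ~ congruent_packings (P x) (P y)].

End Packings.

(* Main.v *)
From HB Require Import structures.
Require Import Defs.
From mathcomp Require Import ring lra measurable_realfun.
Import Order.TTheory GRing.Theory Num.Theory.
Import numFieldNormedType.Exports.
Local Open Scope classical_set_scope.
Local Open Scope ring_scope.

Set Implicit Arguments.
Unset Strict Implicit.
Unset Printing Implicit Defensive.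

(** In the coordinates [e = x / sqrt 3], [y], [f = z / sqrt 8], where the squared
    length is [3 e^2 + y^2 + 8 f^2], a dimer centred at the origin can be given
    the rational vertices [(1, -1, 0)], [(-1, -1, 0)], [(0, 2, 0)], [(0, 0, 1)]
    and [(0, 0, -1)]. The packing of parameter [s], for [3/5 <= s <= 7/10],
    consists of the images of one tetrahedron [T0] under a group [sgroup s],
    generated by the lattice with basis [(s, 3/2, 3/2 s - 39/20)], [(0, 3, 0)],
    [(4/5, 0, 6/5)], the inversion in the origin, and a half-turn that exchanges
    [T0] with the other half of its dimer [X0]. Varying [s] slides layers of
    dimers along the third vector, so the determinant keeps its value [117/25];
    a tetrahedron has volume 1 in these coordinates and there are four of them
    per cell, which gives the density [100/117] ([packing_volume], [det_basis],
    [four_orbits]).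

    The tetrahedra do not overlap because the dimers do not. Every dimer is a
    lattice translate of [X0] or of [-X0], and convex polytopes that do not
    overlap are separated by the functional of a facet of their difference
    body. The difference body of two translates of [X0] has 24 facets, that of
    [X0] and [-X0] is twice a dimer, so non-overlapping is a system of
    inequalities between absolute values of coordinates of lattice vectors
    ([same_sign_separation], [inverted_separation]). The linear form
    [3/2 e - f], which is [39/20] times an integer on the lattice, reduces it to
    few cases. Separation also shows that a nontrivial element of the group
    moves [T0], so the group is simply transitive on tetrahedra and the orbits
    under translations can be counted by the point group.

    The remaining point is that there are no other symmetries, and that distinct
    parameters give incongruent packings; both follow from [rigidity]. An
    isometry is affine, so composing with an element of the group one may assume
    that it permutes the vertices of [T0]. Its linear part maps one lattice of
    the family into another, hence maps [(0, 3, 0)] and [(4/5, 0, 6/5)] to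
    vectors on which [3/2 e - f] is a multiple of [39/20]. The values of
    [3/2 e - f] at the images of these two vectors depend on the permutation
    only, and the identity is the only permutation for which both are such
    multiples. *)

(** * Rational coordinates for the dimer *)

Section Coordinates.
Variable R : realType.
Local Notation V := 'rV[R]_3.
Implicit Types (u v : V) (a : R).

(** The scales make the vertices of a dimer of edge [2 sqrt 3] rational; the
    metric becomes the one of [dotE]. *)
Definition pt (e y f : R) : V := vec3 (Num.sqrt 3 * e) y (Num.sqrt 8 * f).
Definition ce u : R := u 0 0 / Num.sqrt 3.
Definition cy u : R := u 0 1.
Definition cf u : R := u 0 2%:R / Num.sqrt 8.

Lemma sqrt3_gt0 : 0 < Num.sqrt 3 :> R. Proof. by rewrite sqrtr_gt0 ltr0n. Qed.
Lemma sqrt8_gt0 : 0 < Num.sqrt 8 :> R. Proof. by rewrite sqrtr_gt0 ltr0n. Qed.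
Lemma sqrt3_neq0 : Num.sqrt 3 != 0 :> R. Proof. exact: lt0r_neq0 sqrt3_gt0. Qed.
Lemma sqrt8_neq0 : Num.sqrt 8 != 0 :> R. Proof. exact: lt0r_neq0 sqrt8_gt0. Qed.

Lemma vec3E0 (a b c : R) : vec3 a b c 0 0 = a. Proof. by rewrite mxE. Qed.
Lemma vec3E1 (a b c : R) : vec3 a b c 0 1 = b. Proof. by rewrite mxE. Qed.
Lemma vec3E2 (a b c : R) : vec3 a b c 0 2%:R = c. Proof. by rewrite mxE. Qed.

Lemma ce_pt e y f : ce (pt e y f) = e.
Proof. by rewrite /ce vec3E0 mulrC mulKf ?sqrt3_neq0. Qed.
Lemma cy_pt e y f : cy (pt e y f) = y. Proof. exact: vec3E1. Qed.
Lemma cf_pt e y f : cf (pt e y f) = f.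
Proof. by rewrite /cf vec3E2 mulrC mulKf ?sqrt8_neq0. Qed.

Lemma ceD u v : ce (u + v) = ce u + ce v. Proof. by rewrite /ce mxE mulrDl. Qed.
Lemma cyD u v : cy (u + v) = cy u + cy v. Proof. by rewrite /cy mxE. Qed.
Lemma cfD u v : cf (u + v) = cf u + cf v. Proof. by rewrite /cf mxE mulrDl. Qed.
Lemma ceN u : ce (- u) = - ce u. Proof. by rewrite /ce mxE mulNr. Qed.
Lemma cyN u : cy (- u) = - cy u. Proof. by rewrite /cy mxE. Qed.
Lemma cfN u : cf (- u) = - cf u. Proof. by rewrite /cf mxE mulNr. Qed.
Lemma ceZ a u : ce (a *: u) = a * ce u. Proof. by rewrite /ce mxE mulrA. Qed.
Lemma cyZ a u : cy (a *: u) = a * cy u. Proof. by rewrite /cy mxE. Qed.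
Lemma cfZ a u : cf (a *: u) = a * cf u. Proof. by rewrite /cf mxE mulrA. Qed.

Definition coordE :=
  (ceD, cyD, cfD, ceN, cyN, cfN, ceZ, cyZ, cfZ, ce_pt, cy_pt, cf_pt).

Lemma row3P u v : u 0 0 = v 0 0 -> u 0 1 = v 0 1 -> u 0 2%:R = v 0 2%:R -> u = v.
Proof.
move=> h0 h1 h2; apply/rowP => -[[|[|[|//]]] hi].
- by rewrite (_ : Ordinal hi = 0) //; apply: val_inj.
- by rewrite (_ : Ordinal hi = 1) //; apply: val_inj.
- by rewrite (_ : Ordinal hi = 2%:R) //; apply: val_inj.
Qed.

Lemma coordP u v : ce u = ce v -> cy u = cy v -> cf u = cf v -> u = v.
Proof.
move=> he hy hf; apply: row3P => //.
- by apply: (mulIf (invr_neq0 sqrt3_neq0)).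
- by apply: (mulIf (invr_neq0 sqrt8_neq0)).
Qed.

Lemma big_ord3 (W : zmodType) (F : 'I_3 -> W) :
  \sum_(i < 3) F i = F 0 + F 1 + F 2%:R.
Proof.
rewrite !big_ord_recr big_ord0 /= add0r; congr (F _ + F _ + F _); exact: val_inj.
Qed.

Lemma dotE u v : dot u v = 3 * (ce u * ce v) + cy u * cy v + 8 * (cf u * cf v).
Proof.
rewrite /dot big_ord3 /ce /cy /cf.
have h3 : (3 : R) = Num.sqrt 3 ^+ 2 by rewrite sqr_sqrtr.
have h8 : (8 : R) = Num.sqrt 8 ^+ 2 by rewrite sqr_sqrtr.
have := sqrt3_neq0; have := sqrt8_neq0.
rewrite [X in X * (_ / _ * _)]h3 [X in _ + _ + X * _]h8.
by move=> *; field; apply/andP.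
Qed.

Lemma dot_ge0 u : 0 <= dot u u.
Proof.
rewrite dotE; have := sqr_ge0 (ce u); have := sqr_ge0 (cy u).
by have := sqr_ge0 (cf u); nra.
Qed.

Lemma dot_eq0 u : dot u u = 0 -> u = 0.
Proof.
rewrite dotE => h.
have he := sqr_ge0 (ce u); have hy := sqr_ge0 (cy u); have hf := sqr_ge0 (cf u).
have z0 : ce 0 = 0 /\ cy 0 = 0 /\ cf 0 = 0 by rewrite /ce /cy /cf !mxE !mul0r.
apply: coordP.
- by rewrite z0.1; apply/eqP; rewrite -sqrf_eq0; apply/eqP; nra.
- by rewrite z0.2.1; apply/eqP; rewrite -sqrf_eq0; apply/eqP; nra.
- by rewrite z0.2.2; apply/eqP; rewrite -sqrf_eq0; apply/eqP; nra.
Qed.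

Lemma edist_sqr u v : edist u v ^+ 2 = dot (u - v) (u - v).
Proof. by rewrite sqr_sqrtr // dot_ge0. Qed.

Lemma isometryP (g : V -> V) :
  is_isometry g <->
  forall u v, dot (g u - g v) (g u - g v) = dot (u - v) (u - v).
Proof.
split=> hg u v; first by rewrite -!edist_sqr hg.
by rewrite /edist hg.
Qed.

Lemma isometry_comp (g h : V -> V) :
  is_isometry g -> is_isometry h -> is_isometry (g \o h).
Proof. by move=> hg hh u v; rewrite /= hg hh. Qed.

Lemma isometry_inj (g : V -> V) : is_isometry g -> injective g.
Proof.
move=> /isometryP hg u v guv; apply/eqP; rewrite -subr_eq0; apply/eqP.
by apply: dot_eq0; rewrite -hg guv subrr dotE /ce /cy /cf !mxE !mul0r !mulr0 !addr0.
Qed.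

End Coordinates.

(** * Isometries, barycentres and vertices of simplices *)

Section Barycentres.
Variable R : realType.
Local Notation V := 'rV[R]_3.
Implicit Types (u v : V) (p q : 'I_4 -> V) (w : 'I_4 -> R) (g : V -> V).

Lemma big_ord4 (W : zmodType) (F : 'I_4 -> W) :
  \sum_i F i = F 0 + F 1 + F 2%:R + F 3%:R.
Proof.
rewrite !big_ord_recr big_ord0 /= add0r.
by congr (F _ + F _ + F _ + F _); exact: val_inj.
Qed.

Lemma ord4P (i : 'I_4) : [\/ i = 0, i = 1, i = 2%:R | i = 3%:R].
Proof.
case: i => -[|[|[|[|//]]]] hi.
- by apply: Or41; apply: val_inj.
- by apply: Or42; apply: val_inj.
- by apply: Or43; apply: val_inj.
- by apply: Or44; apply: val_inj.
Qed.

Definition sqd u v := dot (u - v) (u - v).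

(** Expresses the distance from [v] to a barycentre by distances between the
    given points only, so that isometries cannot but preserve barycentres. *)
Lemma leibniz_identity p w v : \sum_i w i = 1 ->
  sqd v (\sum_i w i *: p i) =
    \sum_i w i * sqd v (p i) - 2^-1 * \sum_i \sum_j w i * w j * sqd (p i) (p j).
Proof.
rewrite !big_ord4 => w1.
have {w1} -> : w 0 = 1 - w 1 - w 2%:R - w 3%:R by lra.
rewrite /sqd !dotE !coordE; by field.
Qed.

(** By [leibniz_identity] the distance from [g u] to the barycentre of the
    [g (p i)] equals that from [u] to the barycentre of the [p i], which is 0.
    The weights may be negative, so this says that [g] is affine. *)
Lemma isometry_bary g p w : is_isometry g -> \sum_i w i = 1 ->
  g (\sum_i w i *: p i) = \sum_i w i *: g (p i).
Proof.
move=> /isometryP hg w1; apply/eqP; rewrite -subr_eq0; apply/eqP.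
apply: dot_eq0; rewrite -[dot _ _]/(sqd _ _) leibniz_identity //.
set u := \sum_i _.
have hs a b : sqd (g a) (g b) = sqd a b by exact: hg.
under eq_bigr do rewrite hs.
under [X in _ - _ * X]eq_bigr do under eq_bigr do rewrite hs.
rewrite -leibniz_identity // /sqd subrr.
by rewrite dotE /ce /cy /cf !mxE !mul0r !mulr0 !addr0.
Qed.

Lemma isometry_conv4 g p : is_isometry g -> g @` conv4 p = conv4 (g \o p).
Proof.
move=> hg; apply/seteqP; split => [_ [_ [w [w0 w1 ->]] <-]|_ [w [w0 w1 ->]]].
  by exists w; split; rewrite // isometry_bary.
by exists (\sum_i w i *: p i); [exists w | rewrite isometry_bary].
Qed.

Lemma sum_delta (j : 'I_4) : \sum_i (i == j)%:R = 1 :> R.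
Proof. by rewrite (bigD1 j) //= eqxx big1 ?addr0 // => i /negbTE ->. Qed.

Lemma sum_delta_scale p j : \sum_i (i == j)%:R *: p i = p j.
Proof.
rewrite (bigD1 j) //= eqxx scale1r big1 ?addr0 // => i /negbTE ->.
by rewrite scale0r.
Qed.

Lemma conv4_vertex p i : conv4 p (p i).
Proof.
exists (fun j => (j == i)%:R); split => [j||]; first exact: ler0n.
  exact: sum_delta.
by rewrite sum_delta_scale.
Qed.

Definition affinely_free p := forall w w',
  \sum_i w i = 1 -> \sum_i w' i = 1 ->
  \sum_i w i *: p i = \sum_i w' i *: p i -> w =1 w'.

(** Expressing each family in terms of the other gives two stochastic matrices
    whose product is the identity by affine freeness; a nonnegative row can
    only produce a unit row if some vertex [q k] already is [p j]. *)
Lemma conv4_vertices p q : affinely_free p -> conv4 p = conv4 q ->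
  exists2 k : 'I_4 -> 'I_4, injective k & forall j, p j = q (k j).
Proof.
move=> pfree pq.
have /choice[wt hw] : forall k, exists w, [/\ forall i, 0 <= w i, \sum_i w i = 1 &
    q k = \sum_i w i *: p i].
  by move=> k; have : conv4 p (q k) by rewrite pq; apply: conv4_vertex.
have hpq j : exists k, p j = q k.
  have : conv4 q (p j) by rewrite -pq; apply: conv4_vertex.
  case=> v [v0 v1 pj].
  have comb l : \sum_k v k * wt k l = (l == j)%:R.
    move: l; apply: pfree.
    - rewrite exchange_big /= -[RHS]v1; apply: eq_bigr => k _.
      by rewrite -mulr_sumr; have [_ -> _] := hw k; rewrite mulr1.
    - exact: sum_delta.
    - rewrite sum_delta_scale.
      rewrite pj; under eq_bigr do rewrite scaler_suml.
      rewrite exchange_big /=; apply: eq_bigr => k _.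
      have [_ _ ->] := hw k; rewrite scaler_sumr; apply: eq_bigr => i _.
      by rewrite scalerA.
  have [k vk] : exists k, v k != 0.
    apply/not_existsP => h; suff: (1 : R) = 0 by apply/eqP/oner_neq0.
    by rewrite -v1 big1 // => k _; apply/eqP/negbNE/negP/h.
  (* a positive weight [v k] forces the weights of [q k] to vanish off [j] *)
  exists k; have [wk0 wk1 ->] := hw k.
  have wkl l : l != j -> wt k l = 0.
    move=> /negbTE lj; have := comb l; rewrite lj => /psumr_eq0P h.
    have /eqP : v k * wt k l = 0.
      by apply: h => // i _; apply: mulr_ge0 => //; have [] := hw i.
    by rewrite mulf_eq0 (negbTE vk) => /eqP.
  move: wk1; rewrite (bigD1 j) //= big1 ?addr0 => [wkj|l /wkl //].
  rewrite (bigD1 j) //= wkj scale1r big1 ?addr0 // => l /wkl ->.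
  by rewrite scale0r.
have [k hk] := choice hpq; exists k => // i j kij.
have pij : p i = p j by rewrite !hk kij.
have /(_ i) : (fun a => (a == i)%:R : R) =1 (fun a => (a == j)%:R).
  by apply: pfree; rewrite ?sum_delta ?sum_delta_scale.
by rewrite /= eqxx; case: eqP => // _ /eqP; rewrite oner_eq0.
Qed.

End Barycentres.

(** * The packings and their groups *)

Section Construction.
Variable R : realType.
Local Notation V := 'rV[R]_3.
Implicit Types (u v : V) (s : R) (a b : bool) (m k n : int).

Definition sg (a : bool) : R := if a then -1 else 1.
Definition glide (a b : bool) : R := if a (+) b then 1 else 0.

(** The lattice spanned by [(s, 3/2, s * 3/2 - 39/20)], [(0, 3, 0)] and
    [(4/5, 0, 6/5)]: varying [s] slides the first vector along the third. *)
Definition lat s m k n : V :=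
  pt (m%:~R * s + n%:~R * (4 / 5)) (m%:~R * (3 / 2) + k%:~R * 3)
     (n%:~R * (6 / 5) - m%:~R * (39 / 20 - 3 / 2 * s)).

(** The four coset representatives of the translations: the identity, the
    half-turn about the line [e = 1/5], [f = 3/10] for [(true, false)], the
    inversion in the origin for [(true, true)], and their product, a glide
    reflection, for [(false, true)]. *)
Definition point_op (a b : bool) u : V :=
  pt (sg a * ce u + glide a b * (2 / 5)) (sg b * cy u)
     (sg a * cf u + glide a b * (3 / 5)).

Definition act s a b m k n u : V := point_op a b u + lat s m k n.

Definition sgroup s : set (V -> V) :=
  [set g | exists a b m k n, g = act s a b m k n].

(** The centre [(1/5, -4/5, 3/10)] of the face of [p0 0], [p0 1] and [p0 2] is
    the centre of the first dimer. It lies on the half-turn axis, at a quarter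
    of the lattice vector [(4/5, 0, 6/5)]; its height [-4/5] makes the dimer
    touch its inverted copies. *)
Definition p0 (i : 'I_4) : V :=
  [:: pt (6 / 5) (- (9 / 5)) (3 / 10); pt (- (4 / 5)) (- (9 / 5)) (3 / 10);
      pt (1 / 5) (6 / 5) (3 / 10); pt (1 / 5) (- (4 / 5)) (13 / 10)]`_i.

Definition T0 : set V := conv4 p0.
(** The half-turn [point_op true false] exchanges the two halves of this dimer. *)
Definition X0 : set V := T0 `|` point_op true false @` T0.

Definition packing s : set (set V) := [set g @` T0 | g in sgroup s].
Definition dimers s : set (set V) := [set g @` X0 | g in sgroup s].

(** The coordinates [k] and [n] of a product differ from the expected ones by
    integers, because the [y] coordinate of the first lattice vector is half
    of 3 and the glide is half of a lattice vector. *)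
Definition kshift a b : int := if a == b then 0 else if a then 1 else -1.
Definition nshift a b a' b' : int :=
  if a' (+) b' then
    if a (+) b then if a then 0 else 1 else if a then -1 else 0
  else 0.
Definition isg (a : bool) : int := if a then -1 else 1.

Lemma intr_isg a : (isg a)%:~R = sg a. Proof. by case: a. Qed.

Lemma act_comp s a b m k n a' b' m' k' n' :
  act s a b m k n \o act s a' b' m' k' n' =
  act s (a (+) a') (b (+) b') (isg a * m' + m)
    (kshift a b * m' + isg b * k' + k) (isg a * n' + n + nshift a b a' b').
Proof.
apply/funext => u /=; apply: coordP; rewrite /act /point_op /lat !coordE.
- rewrite !(intrD, intrM) !intr_isg /nshift /glide.
  by move: a b a' b' => [] [] [] [] /=; lra.
- rewrite !(intrD, intrM) !intr_isg /kshift.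
  by move: a b a' b' => [] [] [] [] /=; lra.
- rewrite !(intrD, intrM) !intr_isg /nshift /glide.
  by move: a b a' b' => [] [] [] [] /=; lra.
Qed.

Lemma act_id s : act s false false 0 0 0 = id.
Proof.
apply/funext => u; apply: coordP; rewrite /act /point_op /lat !coordE /=;
  by rewrite /glide /=; lra.
Qed.

Lemma act_inv s a b m k n : exists a' b' m' k' n',
  cancel (act s a b m k n) (act s a' b' m' k' n') /\
  cancel (act s a' b' m' k' n') (act s a b m k n).
Proof.
set m' := - isg a * m.
set k' := - isg b * (k + kshift a b * m').
set n' := - isg a * (n + nshift a b a b).
have E1 : act s a b m k n \o act s a b m' k' n' = id.
  rewrite act_comp !addbb -(act_id s); congr act.
  - by rewrite /m' /isg; case: (a); ring.
  - by rewrite /k' /isg; case: (b); ring.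
  - by rewrite /n' /isg; case: (a); ring.
have E2 : act s a b m' k' n' \o act s a b m k n = id.
  rewrite act_comp !addbb -(act_id s) /k' /n' /m'; congr act.
  - by rewrite /isg; case: (a); ring.
  - by rewrite /isg /kshift; case: (b); case: (a) => /=; ring.
  - by rewrite /isg /nshift; case: (b); case: (a) => /=; ring.
exists a, b, m', k', n'; split => u.
  by rewrite -[LHS]/((_ \o act s a b m k n) u) E2.
by rewrite -[LHS]/((act s a b m k n \o _) u) E1.
Qed.

Lemma sgroup_id s : sgroup s id.
Proof. by exists false, false, 0, 0, 0; rewrite act_id. Qed.

Lemma sgroup_comp s g h : sgroup s g -> sgroup s h -> sgroup s (g \o h).
Proof.
move=> [a [b [m [k [n ->]]]]] [a' [b' [m' [k' [n' ->]]]]].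
by rewrite act_comp; do 5!eexists.
Qed.

Lemma sgroup_inv s g : sgroup s g -> exists h, [/\ sgroup s h, g \o h = id & h \o g = id].
Proof.
move=> [a [b [m [k [n ->]]]]].
have [a' [b' [m' [k' [n' [gh hg]]]]]] := act_inv s a b m k n.
exists (act s a' b' m' k' n'); split; first by do 5!eexists.
- by apply/funext => u; apply: hg.
- by apply/funext => u; apply: gh.
Qed.

Lemma sgroup_isometry s g : sgroup s g -> is_isometry g.
Proof.
move=> [a [b [m [k [n ->]]]]]; apply/isometryP => u v.
by rewrite !dotE /act /point_op !coordE; case: a; case: b => /=; ring.
Qed.

Lemma sgroup_translation s m k n : sgroup s (translation (lat s m k n)).
Proof.
exists false, false, m, k, n; apply/funext => u; congr (_ + _).
by apply: coordP; rewrite !coordE /glide /=; lra.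
Qed.

Lemma packing_act s g T : sgroup s g -> packing s T -> packing s (g @` T).
Proof.
move=> gG [h hG <-]; exists (g \o h); first exact: sgroup_comp.
by rewrite image_comp.
Qed.

Lemma dimers_act s g T : sgroup s g -> dimers s T -> dimers s (g @` T).
Proof.
move=> gG [h hG <-]; exists (g \o h); first exact: sgroup_comp.
by rewrite image_comp.
Qed.

Lemma sgroup_leaves_invariant s g (P : set (set V)) : sgroup s g ->
  (forall h S, sgroup s h -> P S -> P (h @` S)) -> leaves_invariant g P.
Proof.
move=> gG hP; have [h [hG gh hg]] := sgroup_inv gG.
split=> [S|S S' _ _ E|S PS]; first exact: hP.
  by have := congr1 (fun X => h @` X) E; rewrite !image_comp hg !image_id.
by exists (h @` S); [exact: hP | rewrite image_comp gh image_id].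
Qed.

End Construction.

Arguments T0 : clear implicits.
Arguments X0 : clear implicits.

(** * Separation of the dimers *)

Section Separation.
Variable R : realType.
Local Notation V := 'rV[R]_3.
Implicit Types (u v : V) (s : R) (a b : bool) (m k n : int).

Lemma p0E : (p0 R 0 = pt (6 / 5) (- (9 / 5)) (3 / 10)) *
  (p0 R 1 = pt (- (4 / 5)) (- (9 / 5)) (3 / 10)) *
  (p0 R 2%:R = pt (1 / 5) (6 / 5) (3 / 10)) *
  (p0 R 3%:R = pt (1 / 5) (- (4 / 5)) (13 / 10)).
Proof. by []. Qed.

(** The six faces of the dimer, relative to its centre. *)
Definition in_hull (e y f : R) :=
  [/\ f - y <= 1, - f - y <= 1 &
   [/\ f + (3 * e + y) / 2 <= 1, f + (- 3 * e + y) / 2 <= 1,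
       - f + (3 * e + y) / 2 <= 1 & - f + (- 3 * e + y) / 2 <= 1]].

Lemma X0_hull u : X0 R u -> in_hull (ce u - 1 / 5) (cy u + 4 / 5) (cf u - 3 / 10).
Proof.
case=> [[w [w0 + ->]]|[_ [w [w0 + ->]] <-]].
all: rewrite !big_ord4 !p0E => w1.
all: have := (w0 0, w0 1, w0 2%:R, w0 3%:R) => -[[[h0 h1] h2] h3].
all: rewrite /point_op /glide !coordE /=.
all: by split; [| |split]; lra.
Qed.

Definition functional (A B C : R) u := A * ce u + B * cy u + C * cf u.

(** Separation by a plane, written without the level of the plane. It passes to
    subsets, and a set with four affinely free points is not separated from any
    set containing it, so it yields disjointness and distinctness at once. *)
Definition separated (S S' : set V) : Prop := exists A B C,
  [\/ A != 0, B != 0 | C != 0] /\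
  forall u u', S u -> S' u' -> functional A B C u <= functional A B C u'.

Lemma separatedW (S1 S2 S1' S2' : set V) : S1 `<=` S2 -> S1' `<=` S2' ->
  separated S2 S2' -> separated S1 S1'.
Proof.
move=> s12 s12' [A [B [C [nz h]]]]; exists A, B, C; split=> // u u' hu hu'.
by apply: h; [apply: s12 | apply: s12'].
Qed.

Lemma norm_signed (x : R) : exists2 t : R, t = 1 \/ t = -1 & t * x = `|x|.
Proof.
case: (ger0P x) => _; first by exists 1; [left | rewrite mul1r].
by exists (-1); [right | rewrite mulN1r].
Qed.

(** The four conditions are the facets, up to signs of the coordinates, of the
    difference body [X0 - X0]: two translates of a convex body do not overlap
    exactly when the translation vector is not interior to that body. *)
Lemma hull_sep_translate v :
  [\/ 1 <= `|cy v| / 3 + `|cf v| / 3,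
      1 <= `|ce v| / 4 + `|cy v| / 4 + `|cf v| / 2,
      1 <= `|ce v| / 2 + `|cf v| / 2 |
      1 <= `|ce v| / 2 + `|cy v| / 6 + `|cf v| / 3] ->
  separated (X0 R) [set u + v | u in X0 R].
Proof.
have key A B C : [\/ A != 0, B != 0 | C != 0] ->
    (forall e y f e' y' f', in_hull e y f -> in_hull e' y' f' ->
       A * (e - e') + B * (y - y') + C * (f - f') <= 1) ->
    1 <= functional A B C v -> separated (X0 R) [set u + v | u in X0 R].
  move=> nz hle hv; exists A, B, C; split=> // u _ /X0_hull hu [u' /X0_hull hu' <-].
  have := hle _ _ _ _ _ _ hu hu'; move: hv.
  by rewrite /functional !coordE; lra.
have [se he <-] := norm_signed (ce v).
have [sy hy <-] := norm_signed (cy v).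
have [sf hf <-] := norm_signed (cf v).
case=> h; [apply: (key 0 (sy / 3) (sf / 3))|apply: (key (se / 4) (sy / 4) (sf / 2))
          |apply: (key (se / 2) 0 (sf / 2))|apply: (key (se / 2) (sy / 6) (sf / 3))].
all: try (by rewrite /functional; lra).
all: try by move=> e1 y1 f1 e2 y2 f2 [? ? [? ? ? ?]] [? ? [? ? ? ?]];
  clear h; case: he; case: hy; case: hf => hf hy he; rewrite ?he ?hy ?hf; lra.
- by apply: Or33; case: hf => ->; apply/eqP; lra.
- by apply: Or33; case: hf => ->; apply/eqP; lra.
- by apply: Or33; case: hf => ->; apply/eqP; lra.
- by apply: Or33; case: hf => ->; apply/eqP; lra.
Qed.

(** A dimer and an inverted copy overlap exactly when the vector from its centre
    to that of the copy is interior to twice the dimer, so the two conditions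
    are the facets of the dimer, scaled by 2. The constants are the doubled
    coordinates of the centre of [X0]. *)
Lemma hull_sep_invert v :
  2 <= `|cf v - 3 / 5| - (cy v + 8 / 5) \/
  2 <= `|cf v - 3 / 5| + (3 * `|ce v - 2 / 5| + (cy v + 8 / 5)) / 2 ->
  separated (X0 R) [set - u + v | u in X0 R].
Proof.
have key A B C : [\/ A != 0, B != 0 | C != 0] ->
    (forall e y f, in_hull e y f -> A * e + B * y + C * f <= 1) ->
    2 <= functional A B C v - A * (2 / 5) + B * (8 / 5) - C * (3 / 5) ->
    separated (X0 R) [set - u + v | u in X0 R].
  move=> nz hle hv; exists A, B, C; split=> // u _ /X0_hull hu [u' /X0_hull hu' <-].
  have := hle _ _ _ hu; have := hle _ _ _ hu'; move: hv.
  by rewrite /functional !coordE; lra.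
have [se he <-] := norm_signed (ce v - 2 / 5).
have [sf hf <-] := norm_signed (cf v - 3 / 5).
case=> h; [apply: (key 0 (-1) sf)|apply: (key (3 / 2 * se) (1 / 2) sf)].
all: try (by rewrite /functional; lra).
all: try by move=> e1 y1 f1 [? ? [? ? ? ?]]; clear h;
  case: he; case: hf => hf he; rewrite ?he ?hf; lra.
- by apply: Or32; apply/eqP; lra.
- by apply: Or32; apply/eqP; lra.
Qed.

Lemma intr_le1 (x : int) : 0 < x -> 1 <= x%:~R :> R.
Proof. by move=> h; rewrite -[1]/(1%:~R) ler_int. Qed.

Lemma int_cases (x : int) : [\/ x = 0, 1 <= x%:~R :> R | x%:~R <= -1 :> R].
Proof.
have [h|h|->] := ltrgt0P x; [apply: Or32|apply: Or33|exact: Or31].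
  exact: intr_le1.
have := @intr_le1 (- x); rewrite oppr_gt0 => /(_ h); rewrite mulrNz; lra.
Qed.

Lemma int_cases5 (x : int) :
  x = 0 \/ [\/ x = 1, x = -1, 2 <= x%:~R :> R | x%:~R <= -2 :> R].
Proof.
have [->|h|h] := int_cases x; first by left.
  have [/eqP|h'|h'] := int_cases (x - 1).
  - by rewrite subr_eq0 => /eqP ->; right; apply: Or41.
  - by right; apply: Or43; rewrite intrB in h'; lra.
  - by exfalso; rewrite intrB in h'; lra.
have [/eqP|h'|h'] := int_cases (x + 1).
- by rewrite addr_eq0 => /eqP ->; right; apply: Or42.
- by exfalso; rewrite intrD in h'; lra.
- by right; apply: Or44; rewrite intrD in h'; lra.
Qed.

Lemma ler_norm2 (x : R) : (x <= `|x|) * (- x <= `|x|).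
Proof. by rewrite ler_norm lerNl -normrN; split=> //; rewrite lerNl ler_norm. Qed.

(** On the lattice [3/2 e - f] is [39/20 m], hence [`|e| / 2 + `|f| / 2] is at
    least 1 as soon as [2 <= `|m|]; the remaining three values of [m] are
    checked by hand. For [m] equal to 1 or -1 the bounds on [s] are what is
    needed. *)
Lemma same_sign_separation s m k n : 3 / 5 <= s <= 7 / 10 ->
  (m, k, n) <> (0, 0, 0) ->
  separated (X0 R) [set u + lat s m k n | u in X0 R].
Proof.
move=> /andP[s1 s2] nz.
pose e := ce (lat s m k n); pose y := cy (lat s m k n); pose f := cf (lat s m k n).
apply: hull_sep_translate; rewrite -/e -/y -/f.
have [e1 e2] := (ler_norm2 e); have [y1 y2] := (ler_norm2 y).
have [f1 f2] := (ler_norm2 f).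
move: e1 e2 y1 y2 f1 f2 nz.
move: `|e| `|y| `|f| => E Y F; rewrite /e /y /f /lat !coordE {e y f}.
have [->|hm] := int_cases5 m.
  have [->|hn|hn] := int_cases n; last 2 first.
  - by move=> *; apply: Or43; lra.
  - by move=> *; apply: Or43; lra.
  by have [->|hk|hk] := int_cases k => *; [|apply: Or41; lra|apply: Or41; lra].
case: hm => [->|->|hm|hm] e1 e2 y1 y2 f1 f2 _.
- have {y1 y2} Y32 : 3 / 2 <= Y.
    by have [k0|hk|hk] := int_cases k; first rewrite k0 in y1; lra.
  have [n0|hn|hn] := int_cases n; last 2 first.
  + by apply: Or44; lra.
  + by apply: Or41; lra.
  by rewrite n0 in e1 e2 f1 f2; apply: Or42; lra.
- have {y1 y2} Y32 : 3 / 2 <= Y.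
    by have [k0|hk|hk] := int_cases k; first rewrite k0 in y2; lra.
  have [n0|hn|hn] := int_cases n; last 2 first.
  + by apply: Or41; lra.
  + by apply: Or44; lra.
  by rewrite n0 in e1 e2 f1 f2; apply: Or42; lra.
- by apply: Or43; lra.
- by apply: Or43; lra.
Qed.

(** With the same invariant, [`|f| + 3/2 `|e|] is at least [39/20 `|m|] for the
    vector joining the centres. *)
Lemma inverted_separation s m k n : 3 / 5 <= s <= 7 / 10 ->
  separated (X0 R) [set - u + lat s m k n | u in X0 R].
Proof.
move=> /andP[s1 s2]; apply: hull_sep_invert.
pose e := ce (lat s m k n) - 2 / 5; pose y := cy (lat s m k n) + 8 / 5.
pose f := cf (lat s m k n) - 3 / 5; rewrite -/e -/y -/f.
have [e1 e2] := (ler_norm2 e); have [f1 f2] := (ler_norm2 f).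
have hy : y = m%:~R * (3 / 2) + k%:~R * 3 + 8 / 5 by rewrite /y /lat coordE.
move: e1 e2 f1 f2.
move: `|e| `|f| y hy => E F y hy; rewrite /e /f /lat !coordE {e f}.
have [m0|hm] := int_cases5 m.
  rewrite m0 in hy *.
  have nn : 1 <= n%:~R :> R \/ n%:~R <= 0 :> R.
    by have [->|hn|hn] := int_cases n; [right|left|right; lra].
  move=> e1 e2 f1 f2.
  have [k0|hk|hk] := int_cases k.
  - by rewrite k0 in hy; right; case: nn => hn; lra.
  - by right; case: nn => hn; lra.
  - by left; case: nn => hn; lra.
case: hm => [hm|hm|hm|hm] e1 e2 f1 f2; rewrite ?hm in hy e1 e2 f1 f2.
- have [/eqP|hk|hk] := int_cases (k + 1).
  + by rewrite addr_eq0 => /eqP hk; rewrite hk in hy; right; lra.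
  + by rewrite intrD in hk; right; lra.
  + by rewrite intrD in hk; left; lra.
- have [hk|hk|hk] := int_cases k.
  + by rewrite hk in hy; right; lra.
  + by right; lra.
  + by left; lra.
- by have [h|h] := lerP y (- (19 / 5)); [left|right]; lra.
- by have [h|h] := lerP y (- (19 / 5)); [left|right]; lra.
Qed.

End Separation.

(** * Disjointness of the tetrahedra *)

Section Disjointness.
Variable R : realType.
Local Notation V := 'rV[R]_3.
Implicit Types (u v : V) (s : R) (a b : bool) (m k n : int) (S T X : set V).

Lemma interior_push S u d : interior S u -> \forall e \near (0 : R), S (u + e *: d).
Proof.
move=> Su; have : (fun e : R => u + e *: d) @ (0 : R) --> u.
  rewrite -[X in _ --> X]addr0 -(scale0r d); apply: cvgD; first exact: cvg_cst.
  exact: scalel_continuous.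
by move=> /(_ _ Su).
Qed.

Lemma functionalD (A B C t : R) u d :
  functional A B C (u + t *: d) = functional A B C u + t * functional A B C d.
Proof. by rewrite /functional !coordE; ring. Qed.

(** Pushing a common interior point along the gradient of the functional, in
    both directions, contradicts the separation. *)
Lemma separated_interior S T : separated S T -> interior S `&` interior T = set0.
Proof.
move=> [A [B [C [nz sep]]]]; apply/seteqP; split=> // u [Su Tu].
set d := pt A B C.
have dpos : 0 < functional A B C d.
  rewrite /functional !coordE.
  have := sqr_ge0 A; have := sqr_ge0 B; have := sqr_ge0 C.
  have sq (x : R) : x != 0 -> 0 < x ^+ 2 by rewrite lt0r sqrf_eq0 sqr_ge0 => ->.
  by case: nz => /sq; nra.
near (0 : R)^'+ => e.
have e0 : 0 < e by [].
have : functional A B C (u + e *: d) <= functional A B C (u + e *: - d).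
  apply: sep; near: e; apply: cvg_within; exact: interior_push.
rewrite scalerN -scaleNr !functionalD.
nra.
Unshelve. all: by end_near. Qed.

Lemma separated_act s g S T : sgroup s g -> separated S T ->
  separated (g @` S) (g @` T).
Proof.
move=> [a [b [m [k [n ->]]]]] [A [B [C [nz sep]]]].
exists (sg R a * A), (sg R b * B), (sg R a * C); split.
  have sg0 c : sg R c != 0 by case: c; rewrite /= ?oppr_eq0 oner_eq0.
  by case: nz => h; [apply: Or31|apply: Or32|apply: Or33]; rewrite mulf_neq0.
move=> _ _ [u Su <-] [v Tv <-]; have := sep _ _ Su Tv.
rewrite /functional /act /point_op !coordE.
by case: a; case: b => /=; lra.
Qed.

Lemma T0_not_separated S : separated (T0 R) S -> ~ T0 R `<=` S.
Proof.
move=> [A [B [C [nz sep]]]] T0S.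
have h i j : functional A B C (p0 R i) <= functional A B C (p0 R j).
  by apply: sep; [|apply: T0S]; apply: conv4_vertex.
have := (h 0 1, h 1 0, h 0 2%:R, h 2%:R 0, h 0 3%:R, h 3%:R 0).
rewrite /functional !p0E !coordE => -[[[[[h1 h2] h3] h4] h5] h6].
by case: nz => /eqP; apply; lra.
Qed.

Lemma X0_symmetric : point_op true false @` X0 R = X0 R.
Proof.
have K : point_op true false \o point_op true false = @id V.
  by apply/funext => u; apply: coordP; rewrite /= /point_op /glide !coordE /=; lra.
by rewrite /X0 image_setU image_comp K image_id setUC.
Qed.

(** Elements without inversion map [X0] to a translate, since the half-turn
    preserves [X0]. *)
Lemma act_X0_same s a m k n :
  act s a false m k n @` X0 R = [set u + lat s m k n | u in X0 R].
Proof.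
have -> : [set u + lat s m k n | u in X0 R] = act s false false m k n @` X0 R.
  congr (image _ _); apply/funext => u; congr (_ + _).
  by apply: coordP; rewrite /point_op /glide !coordE /=; lra.
case: a => //; rewrite -[in RHS]X0_symmetric image_comp; congr (image _ _).
apply/funext => u; apply: coordP.
all: by rewrite /act /point_op /glide !coordE /=; lra.
Qed.

Lemma act_X0_inverted s a m k n : exists n',
  act s a true m k n @` X0 R = [set - u + lat s m k n' | u in X0 R].
Proof.
case: a.
  exists n; congr (image _ _); apply/funext => u; congr (_ + _).
  by apply: coordP; rewrite /point_op /glide !coordE /=; lra.
exists (n + 1); rewrite -[in RHS]X0_symmetric image_comp; congr (image _ _).
apply/funext => u; apply: coordP.
all: by rewrite /act /point_op /lat /glide !coordE /= ?intrD; lra.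
Qed.

Lemma dimer_separation s a b m k n : 3 / 5 <= s <= 7 / 10 ->
  (b, m, k, n) <> (false, 0, 0, 0) ->
  separated (X0 R) (act s a b m k n @` X0 R).
Proof.
move=> Js; case: b => nz.
  have [n' ->] := act_X0_inverted s a m k n.
  exact: inverted_separation.
rewrite act_X0_same; apply: same_sign_separation => // -[m0 k0 n0].
by rewrite m0 k0 n0 in nz.
Qed.

Lemma halves_separation s : separated (T0 R) (act s true false 0 0 0 @` T0 R).
Proof.
exists 0, 0, (-1); split=> [|_ _ [w [w0 + ->]] [_ [w' [w0' + ->] <-]]].
  by apply: Or33; rewrite oppr_eq0 oner_eq0.
rewrite !big_ord4 /functional /act /point_op /lat /glide !p0E !coordE /=.
by have := w0 3%:R; have := w0' 3%:R; lra.
Qed.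

Lemma tetrahedron_separation s a b m k n : 3 / 5 <= s <= 7 / 10 ->
  (a, b, m, k, n) <> (false, false, 0, 0, 0) ->
  separated (T0 R) (act s a b m k n @` T0 R).
Proof.
move=> Js nz.
have [[b0 m0 k0 n0]|nz'] := pselect ((b, m, k, n) = (false, 0, 0, 0)).
  by move: nz; rewrite b0 m0 k0 n0; case: (a) => // _; exact: halves_separation.
apply: separatedW (dimer_separation a Js nz') => [u|_ [u uT <-]]; first by left.
by exists u => //; left.
Qed.

(** A nontrivial element moves [T0] to a tetrahedron separated from it, so the
    group is simply transitive on the tetrahedra. *)
Lemma sgroup_free s g : 3 / 5 <= s <= 7 / 10 -> sgroup s g ->
  T0 R `<=` g @` T0 R -> g = id.
Proof.
move=> Js [a [b [m [k [n ->]]]]] sub; apply: contrapT => nid.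
apply: T0_not_separated sub; apply: tetrahedron_separation => // -[a0 b0 m0 k0 n0].
by apply: nid; rewrite a0 b0 m0 k0 n0 act_id.
Qed.

Lemma packing_disjoint s T T' : 3 / 5 <= s <= 7 / 10 ->
  packing s T -> packing s T' -> T <> T' -> interior T `&` interior T' = set0.
Proof.
move=> Js [g gG <-] [h hG <-] gh; apply: separated_interior.
have [g' [g'G gg' g'g]] := sgroup_inv gG.
have -> : h @` T0 R = g @` ((g' \o h) @` T0 R).
  by rewrite !image_comp compA gg'.
apply: separated_act gG _.
have [a [b [m [k [n e]]]]] := sgroup_comp g'G hG.
rewrite e; apply: tetrahedron_separation => // -[a0 b0 m0 k0 n0].
have e1 : g' \o h = id by rewrite e a0 b0 m0 k0 n0 act_id.
by apply: gh; rewrite -[g]/(g \o id) -e1 compA gg'.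
Qed.

(** Unless [g] stabilizes [X0], the dimers [X0] and [g @` X0] are separated. *)
Lemma dimer_unique s g : 3 / 5 <= s <= 7 / 10 -> sgroup s g ->
  T0 R `<=` g @` X0 R -> g @` X0 R = X0 R.
Proof.
move=> Js [a [b [m [k [n ->]]]]] sub.
have [[b0 m0 k0 n0]|nz] := pselect ((b, m, k, n) = (false, 0, 0, 0)).
  rewrite b0 m0 k0 n0 act_X0_same -(act_X0_same s false) act_id.
  exact: image_id.
exfalso; apply: T0_not_separated sub.
apply: separatedW (dimer_separation a Js nz) => // u uT; by left.
Qed.

End Disjointness.

(** * Rigidity: symmetries and congruences *)

Section Rigidity.
Variable R : realType.
Local Notation V := 'rV[R]_3.
Implicit Types (u v : V) (s : R) (a b : bool) (m k n : int) (g h : V -> V).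

(** Barycentric coordinates with respect to the vertices of [T0]. *)
Definition bary u (i : 'I_4) : R :=
  let e := ce u - 1 / 5 in let y := cy u + 4 / 5 in let f := cf u - 3 / 10 in
  [:: (2 * (1 - f) - y + 3 * e) / 6; (2 * (1 - f) - y - 3 * e) / 6;
      (1 - f + y) / 3; f]`_i.

Lemma baryE u : let e := ce u - 1 / 5 in let y := cy u + 4 / 5 in
  let f := cf u - 3 / 10 in
  (bary u 0 = (2 * (1 - f) - y + 3 * e) / 6) *
  (bary u 1 = (2 * (1 - f) - y - 3 * e) / 6) *
  (bary u 2%:R = (1 - f + y) / 3) * (bary u 3%:R = f).
Proof. by []. Qed.

Lemma bary_sum u : \sum_i bary u i = 1.
Proof. by rewrite big_ord4 !baryE; lra. Qed.

Lemma bary_comb u : \sum_i bary u i *: p0 R i = u.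
Proof. by rewrite big_ord4 !baryE; apply: coordP; rewrite !p0E !coordE; lra. Qed.

Lemma p0_free : affinely_free (p0 R).
Proof.
move=> w w'; rewrite !big_ord4 !p0E => w1 w1' E.
have := congr1 (@ce R) E; have := congr1 (@cy R) E; have := congr1 (@cf R) E.
rewrite !coordE => he hf hy i.
by have [->|->|->|->] := ord4P i; lra.
Qed.

Lemma isometry_fix_id g : is_isometry g -> (forall i, g (p0 R i) = p0 R i) -> g = id.
Proof.
move=> hg fix_p; apply/funext => u; rewrite -[u in LHS]bary_comb.
rewrite (isometry_bary _ hg (bary_sum u)); under eq_bigr do rewrite fix_p.
exact: bary_comb.
Qed.

Lemma isometry_vertices g h : is_isometry g -> is_isometry h ->
  g @` T0 R = h @` T0 R ->
  exists2 k : 'I_4 -> 'I_4, injective k & forall j, g (p0 R j) = h (p0 R (k j)).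
Proof.
move=> hg hh; rewrite /T0 !isometry_conv4 //; apply: conv4_vertices.
move=> w w' w1 w1'; rewrite /= -!isometry_bary // => /(isometry_inj hg).
exact: p0_free.
Qed.

Lemma isometry_additive g u v : is_isometry g -> g (u + v) = g u + (g v - g 0).
Proof.
move=> hg.
pose p (i : 'I_4) : V := [:: u; v; 0; 0]`_i.
pose w (i : 'I_4) : R := [:: 1; 1; -1; 0]`_i.
have w1 : \sum_i w i = 1 by rewrite big_ord4 /w /=; lra.
have := isometry_bary p hg w1; rewrite !big_ord4 /w /p /=.
by rewrite !scale1r !scale0r !scaler0 !addr0 scaleN1r addrA.
Qed.

(** Weights of sum 0 represent vectors: this is the linear part of [g]. *)
Lemma isometry_shift g (c : 'I_4 -> R) (p : 'I_4 -> V) u :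
  is_isometry g -> \sum_i c i = 0 ->
  g (u + \sum_i c i *: p i) = g u + \sum_i c i *: g (p i).
Proof.
move=> hg c0; rewrite isometry_additive //; congr (_ + _).
suff : g (p 0 + \sum_i c i *: p i) = g (p 0) + \sum_i c i *: g (p i).
  by rewrite isometry_additive // => /addrI.
pose w i := c i + (i == 0)%:R.
have w1 : \sum_i w i = 1 by rewrite big_split /= c0 sum_delta add0r.
have comb (q : 'I_4 -> V) : \sum_i w i *: q i = q 0 + \sum_i c i *: q i.
  rewrite addrC -[q 0](sum_delta_scale q) -big_split /=.
  by apply: eq_bigr => i _; rewrite scalerDl.
by rewrite -comb isometry_bary // comb.
Qed.

Lemma isometry_translation v : is_isometry (translation v).
Proof. by apply/isometryP => x y; rewrite /translation opprD addrACA subrr addr0. Qed.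

Lemma perm4_cases (k : 'I_4 -> 'I_4) (Q : 'I_4 -> 'I_4 -> 'I_4 -> 'I_4 -> Prop) :
  injective k ->
  (forall i j l t : 'I_4, uniq [:: i; j; l; t] -> Q i j l t) ->
  Q (k 0) (k 1) (k 2%:R) (k 3%:R).
Proof.
move=> kinj; apply.
by rewrite -[X in uniq X]/(map k [:: 0; 1; 2%:R; 3%:R]) map_inj_uniq.
Qed.

(** Only a group element with trivial linear part can carry [T0] to a translate
    of itself: comparing vertices shows that [T0] is not a translate of its image
    under the half-turn, the inversion or the reflection. *)
Lemma packing_translate s v : packing s (translation v @` T0 R) ->
  exists m k n, v = lat s m k n.
Proof.
case=> _ [a [b [m [k [n ->]]]]] E; exists m, k, n.
have hG : sgroup s (act s a b m k n) by do 5!eexists.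
have [f finj fE] :=
  isometry_vertices (isometry_translation v) (sgroup_isometry hG) (esym E).
set l := lat s m k n in fE *.
have coords i j : translation v (p0 R j) = act s a b m k n (p0 R i) ->
  [/\ ce (p0 R j) + ce v = sg R a * ce (p0 R i) + (glide R a b * (2 / 5) + ce l),
     cy (p0 R j) + cy v = sg R b * cy (p0 R i) + cy l &
     cf (p0 R j) + cf v = sg R a * cf (p0 R i) + (glide R a b * (3 / 5) + cf l)].
  move=> E'; have := congr1 (@ce R) E'; have := congr1 (@cy R) E'.
  have := congr1 (@cf R) E'; rewrite /translation /act /point_op -/l !coordE.
  by split; lra.
have [a0 b0 f0] : [/\ a = false, b = false & f 0 = 0].
  have := coords _ _ (fE 3%:R); have := coords _ _ (fE 2%:R).
  have := coords _ _ (fE 1); have := coords _ _ (fE 0).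
  move: (glide R a b * (2 / 5) + ce l) (cy l) (glide R a b * (3 / 5) + cf l).
  move: (ce v) (cy v) (cf v) => {E hG} x y z x' y' z'.
  pattern (f 0), (f 1), (f 2%:R), (f 3%:R).
  match goal with |- ?Q _ _ _ _ => apply: (@perm4_cases f Q finj) end.
  move=> i j r t; rewrite !p0E !coordE {coords fE}.
  have [->|->|->|->] := ord4P i; have [->|->|->|->] := ord4P j => //;
  have [->|->|->|->] := ord4P r => //; have [->|->|->|->] := ord4P t => // _;
  rewrite !p0E !coordE; case: (a); case: (b); rewrite /= =>
    -[x0 y0 z0] [x1 y1 z1] [x2 y2 z2] [x3 y3 z3]; split => //; exfalso;
  first [ clear x0 x1 x2 x3 y0 y1 y2 y3; lra | clear x0 x1 x2 x3 z0 z1 z2 z3; lra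
        | clear y0 y1 y2 y3 z0 z1 z2 z3; lra ].
have := fE 0; rewrite f0 a0 b0 /translation /act => e.
apply: (@addrI _ (p0 R 0)); rewrite e; congr (_ + _).
by apply: coordP; rewrite /point_op /glide !coordE /=; lra.
Qed.


(** Here [f] is the permutation of the vertices induced by an isometry [g]
    fixing [T0], and [phi i] is the value of [3/2 e - f] at [g (p0 i)]; the two
    last hypotheses say that [g] maps [(0, 3, 0)] and [(4/5, 0, 6/5)] to vectors
    on which [3/2 e - f] is a multiple of [39/20], as on every lattice of the
    family. The first vector excludes all nontrivial permutations except the
    transposition of the vertices 0 and 1, and the second excludes that one. *)
Lemma vertex_permutation_trivial (f : 'I_4 -> 'I_4) (phi : 'I_4 -> R) (x y : int) :
  injective f ->
  phi (f 0) = 3 / 2 -> phi (f 1) = - (3 / 2) -> phi (f 2%:R) = 0 ->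
  phi (f 3%:R) = -1 ->
  phi 2%:R - (phi 0 + phi 1) / 2 = 39 / 20 * x%:~R ->
  6 / 5 * phi 3%:R - 4 / 5 * phi 1 - 2 / 5 * phi 2%:R = 39 / 20 * y%:~R ->
  [/\ f 0 = 0, f 1 = 1, f 2%:R = 2%:R & f 3%:R = 3%:R].
Proof.
move=> finj; have gap (z : int) (r : R) : r = 39 / 20 * z%:~R ->
    r = 0 \/ [\/ r = 39 / 20, r = - (39 / 20), 39 / 10 <= r | r <= - (39 / 10)].
  have [->|[->|->|h|h]] := int_cases5 R z => ->; [left|right..]; first lra.
  - by apply: Or41; lra.
  - by apply: Or42; lra.
  - by apply: Or43; lra.
  - by apply: Or44; lra.
move=> h0 h1 h2 h3 /gap hb /gap hc {gap}; move: h0 h1 h2 h3 hb hc.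
pattern (f 0), (f 1), (f 2%:R), (f 3%:R).
match goal with |- ?Q _ _ _ _ => apply: (@perm4_cases f Q finj) end.
move=> i j r t.
have [->|->|->|->] := ord4P i; have [->|->|->|->] := ord4P j => //;
have [->|->|->|->] := ord4P r => //; have [->|->|->|->] := ord4P t => // _;
move=> -> -> -> -> hb hc; split => //; exfalso;
first [ by clear hc; case: hb => [hb|[hb|hb|hb|hb]]; lra
      | by clear hb; case: hc => [hc|[hc|hc|hc|hc]]; lra ].
Qed.

(** An isometry fixing [T0] permutes its vertices, and its linear part maps the
    lattice of [s] into that of [s'], since the translates of [T0] in the
    packing go to translates of [T0]. So it is the identity by
    [vertex_permutation_trivial], and comparing the vectors
    [(s, 3/2, s * 3/2 - 39/20)] gives [s = s'] because [s - s'] is too small to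
    be a nonzero multiple of [4/5]. *)
Lemma rigidity_at_T0 s s' g :
  3 / 5 <= s <= 7 / 10 -> 3 / 5 <= s' <= 7 / 10 -> is_isometry g ->
  g @` T0 R = T0 R -> (forall T, packing s T -> packing s' (g @` T)) ->
  g = id /\ s = s'.
Proof.
move=> /andP[s1 s2] /andP[s1' s2'] hg gT0 gP.
have idiso : is_isometry (@id V) by [].
have [f finj fE] : exists2 k : 'I_4 -> 'I_4, injective k &
    forall j, p0 R j = g (p0 R (k j)).
  by apply: (isometry_vertices idiso hg); rewrite gT0 image_id.
have shift_lat (c : 'I_4 -> R) m k n : \sum_i c i = 0 ->
    \sum_i c i *: p0 R i = lat s m k n ->
    exists m' k' n', \sum_i c i *: g (p0 R i) = lat s' m' k' n'.
  move=> c0 cE; apply: packing_translate.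
  have -> : translation (\sum_i c i *: g (p0 R i)) @` T0 R =
      g @` (translation (lat s m k n) @` T0 R).
    rewrite -[in LHS]gT0 !image_comp; congr (image _ _); apply/funext => u.
    by rewrite /= /translation -cE isometry_shift.
  by apply: gP; exists (translation (lat s m k n)) => //; apply: sgroup_translation.
have functional_lat m k n :
    3 / 2 * ce (lat s' m k n) - cf (lat s' m k n) = 39 / 20 * m%:~R.
  by rewrite /lat !coordE; lra.
pose phi u := 3 / 2 * ce u - cf u.
have [mb hb] : exists m, phi (g (p0 R 2%:R)) -
    (phi (g (p0 R 0)) + phi (g (p0 R 1))) / 2 = 39 / 20 * m%:~R.
  (* (0, 3, 0) as a combination of the vertices of T0 *)
  pose c (i : 'I_4) : R := [:: - 2^-1; - 2^-1; 1; 0]`_i.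
  have [||m [k [n e]]] := shift_lat c 0 1 0.
  - by rewrite big_ord4 /c /=; lra.
  - by rewrite big_ord4 /c /=; apply: coordP; rewrite /lat !p0E !coordE; lra.
  exists m; rewrite -(functional_lat m k n) -e big_ord4 /phi /c /= !coordE; lra.
have [mc hc] : exists m, 6 / 5 * phi (g (p0 R 3%:R)) -
    4 / 5 * phi (g (p0 R 1)) - 2 / 5 * phi (g (p0 R 2%:R)) = 39 / 20 * m%:~R.
  (* (4/5, 0, 6/5) as a combination of the vertices of T0 *)
  pose c (i : 'I_4) : R := [:: 0; - (4 / 5); - (2 / 5); 6 / 5]`_i.
  have [||m [k [n e]]] := shift_lat c 0 0 1.
  - by rewrite big_ord4 /c /=; lra.
  - by rewrite big_ord4 /c /=; apply: coordP; rewrite /lat !p0E !coordE; lra.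
  exists m; rewrite -(functional_lat m k n) -e big_ord4 /phi /c /= !coordE; lra.
have ffix : [/\ f 0 = 0, f 1 = 1, f 2%:R = 2%:R & f 3%:R = 3%:R].
  apply: (vertex_permutation_trivial (phi := fun i => phi (g (p0 R i))))
    finj _ _ _ _ hb hc;
    by rewrite /= -fE p0E /phi !coordE; lra.
have gid : g = id.
  apply: isometry_fix_id => // i; have [f0 f1 f2 f3] := ffix.
  by have [->|->|->|->] := ord4P i; rewrite [RHS]fE ?f0 ?f1 ?f2 ?f3.
split=> //.
have : packing s' (translation (lat s 1 0 0) @` T0 R).
  rewrite -[X in packing _ X]image_id -gid; apply: gP.
  by exists (translation (lat s 1 0 0)) => //; apply: sgroup_translation.
move=> /packing_translate[m [k [n E]]].
have := congr1 (@ce R) E; have := congr1 (@cf R) E; rewrite /lat !coordE.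
have [->|[->|->|hm|hm]] := int_cases5 R m; try (by move=> *; exfalso; lra).
by have [->|hn|hn] := int_cases R n; try (by move=> *; exfalso; lra); lra.
Qed.

(** Transitivity reduces to an isometry fixing [T0]. For [s = s'] this says that
    the packing has no further symmetries, and in general that distinct
    parameters give incongruent packings. *)
Lemma rigidity s s' g :
  3 / 5 <= s <= 7 / 10 -> 3 / 5 <= s' <= 7 / 10 -> is_isometry g ->
  (forall T, packing s T -> packing s' (g @` T)) -> s = s' /\ sgroup s' g.
Proof.
move=> Js Js' hg gP.
have T0s : packing s (T0 R) by exists id; [exact: sgroup_id | exact: image_id].
have [h hG hT0] := gP _ T0s.
have [h' [h'G hh' h'h]] := sgroup_inv hG.
have [||| e ss'] := @rigidity_at_T0 s s' (h' \o g) Js Js'.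
- exact: isometry_comp (sgroup_isometry h'G) hg.
- by rewrite -image_comp -hT0 image_comp h'h image_id.
- by move=> T /gP gT; rewrite -image_comp; apply: packing_act.
by split=> //; rewrite -[g]/(id \o g) -hh' -compA e.
Qed.

End Rigidity.

(** * Volume of the tetrahedra *)

Section Volume.
Variable R : realType.
Local Notation V := 'rV[R]_3.
Local Notation mu := (@lebesgue_measure R).
Implicit Types (u v : V) (s : R) (a b : bool) (m k n : int).

(** All tetrahedra of the packing are given by the same inequalities up to the
    signs of the coordinates and the position of the centre [(E, Y, F)], because
    the point group acts by diagonal matrices. *)
Lemma act_T0P s a b m k n : exists E Y F : R, forall u,
  (act s a b m k n @` T0 R) u <->
  [/\ 0 <= sg R a * (cf u - F),
      0 <= 1 - sg R a * (cf u - F) + sg R b * (cy u - Y),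
      3 * (ce u - E) <= 2 * (1 - sg R a * (cf u - F)) - sg R b * (cy u - Y) &
      - (3 * (ce u - E)) <=
        2 * (1 - sg R a * (cf u - F)) - sg R b * (cy u - Y)].
Proof.
pose c := act s a b m k n (pt (1 / 5) (- (4 / 5)) (3 / 10)).
exists (ce c), (cy c), (cf c) => u; split.
  move=> [_ [w [w0 + ->]] <-]; rewrite !big_ord4 => w1.
  have := (w0 0, w0 1, w0 2%:R, w0 3%:R) => -[[[h0 h1] h2] h3].
  rewrite /c /act /point_op !p0E !coordE.
  by case: (a); case: (b) => /=; split; lra.
move=> [h1 h2 h3 h4].
have [a' [b' [m' [k' [n' [K1 K2]]]]]] := act_inv s a b m k n.
exists (act s a' b' m' k' n' u); last exact: K2.
move: (act s a' b' m' k' n' u) (K2 u) => w uE.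
exists (bary w); split; [|exact: bary_sum|by rewrite bary_comb].
move: h1 h2 h3 h4; rewrite /c -uE /act /point_op !coordE.
by case: (a); case: (b) => /= h1 h2 h3 h4 i; have [->|->|->|->] := ord4P i;
  rewrite baryE; lra.
Qed.

Lemma integral_quadratic (c0 c1 c2 x y : R) : x <= y ->
  (\int[mu]_(t in `[x, y]) (c0 + c1 * t + c2 * t ^+ 2)%:E =
   (c0 * (y - x) + c1 / 2 * (y ^+ 2 - x ^+ 2) + c2 / 3 * (y ^+ 3 - x ^+ 3))%:E)%E.
Proof.
rewrite le_eqVlt => /orP[/eqP ->|xy].
  by rewrite set_itv1 integral_set1; congr EFin; ring.
pose P : {poly R} := c0 *: 'X + (c1 / 2) *: 'X^2 + (c2 / 3) *: 'X^3.
have PE t : P^`().[t] = c0 + c1 * t + c2 * t ^+ 2.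
  rewrite /P !(derivD, derivZ, derivX, derivXn) !(hornerE, hornerMn) /=.
  by field.
under eq_integral do rewrite -PE.
rewrite (@continuous_FTC2 _ _ (horner P)) //.
- by rewrite -EFinB; congr EFin; rewrite /P !hornerE /=; field.
- by apply: continuous_subspaceT; exact: continuous_horner.
- split=> [t _||]; first exact: derivable_horner.
  + by apply: cvg_at_right_filter; exact: continuous_horner.
  + by apply: cvg_at_left_filter; exact: continuous_horner.
- by move=> t _; rewrite derivE.
Qed.


(** Lines along the first axis meet the horizontal triangle of inradius [r] in
    segments. *)
Lemma triangle_section (b : bool) (r E Y y : R) :
  let y' := sg R b * (y - Y) in
  mu (ysection [set p : R * R | [/\ 0 <= r + sg R b * (p.2 - Y),
      3 * (p.1 / Num.sqrt 3 - E) <= 2 * r - sg R b * (p.2 - Y) &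
      - (3 * (p.1 / Num.sqrt 3 - E)) <= 2 * r - sg R b * (p.2 - Y)]] y) =
  (if (- r <= y') && (y' <= 2 * r) then 2 * Num.sqrt 3 / 3 * (2 * r - y') else 0)%:E.
Proof.
move=> y'; have s3 := sqrt3_gt0 R.
have lo (x c : R) : (Num.sqrt 3 * c <= x) = (c <= x / Num.sqrt 3).
  by rewrite ler_pdivlMr // mulrC.
have hi (x c : R) : (x <= Num.sqrt 3 * c) = (x / Num.sqrt 3 <= c).
  by rewrite ler_pdivrMr // mulrC.
case: ifPn => [/andP[h1 h2]|h].
  rewrite (_ : ysection _ _ =
    `[Num.sqrt 3 * (E - (2 * r - y') / 3), Num.sqrt 3 * (E + (2 * r - y') / 3)]%classic).
    rewrite lebesgue_measure_itv /= lte_fin ltr_pM2l //.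
    case: ltP => hlt; first by rewrite -EFinB; congr EFin; field.
    have -> : y' = 2 * r by lra.
    by rewrite subrr mulr0.
  apply/seteqP; split=> x /=; rewrite /ysection /= inE /= -/y' in_itv /=.
    by move=> [_ h3 h4]; rewrite lo hi; apply/andP; split; lra.
  by rewrite lo hi => /andP[h3 h4]; split; lra.
rewrite (_ : ysection _ _ = set0) ?measure0 //.
apply/seteqP; split=> x //=; rewrite /ysection /= inE /= -/y' => -[h1 h2 h3].
by move/negP: h; apply; apply/andP; split; lra.
Qed.


Lemma measurable_le_set d (T : measurableType d) (f g : T -> R) :
  measurable_fun setT f -> measurable_fun setT g ->
  measurable [set t | f t <= g t].
Proof.
by move=> mf mg; have := measurable_fun_le measurableT mf mg; rewrite setTI.
Qed.

(** The product measure integrates over the first factor, whereas here the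
    slices at fixed last coordinate are the simple ones. *)
Lemma product_measure_swap d1 d2 (T1 : measurableType d1) (T2 : measurableType d2)
    (m1 : {sigma_finite_measure set T1 -> \bar R})
    (m2 : {sigma_finite_measure set T2 -> \bar R}) (A : set (T1 * T2)) :
  measurable A -> ((m1 \x m2) A = \int[m2]_y m1 (ysection A y))%E.
Proof.
move=> mA; rewrite (@product_measure_unique _ _ _ _ _ _ _ (m1 \x^ m2)%E) //.
by move=> X Y mX mY; apply: product_measure2E.
Qed.

(** A name for the plane measure, to which the sigma-finiteness needed for slicing
    space by horizontal planes can be attached. *)
Definition area : set (measurableTypeR R * measurableTypeR R) -> \bar R :=
  (mu \x mu)%E.

HB.instance Definition _ := Measure.on area.

Lemma area_sigma_finite : sigma_finite setT area.
Proof.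
have /sigma_finiteP[F [TF ndF Foo]] := sigma_finiteT mu.
exists (fun i => F i `*` F i) => [|i]; last first.
  have [mF Fi] := Foo i; split; first exact: measurableX.
  rewrite /area [X in (X < _)%E]product_measure1E //.
  by rewrite lte_mul_pinfty // ge0_fin_numE.
rewrite -setXTT TF; apply/seteqP; split=> [[x y] [/= [i _ Fx] [j _ Fy]]|[x y]].
  exists (maxn i j) => //; split.
  - by move: Fx; apply/subsetPset/ndF/leq_maxl.
  - by move: Fy; apply/subsetPset/ndF/leq_maxr.
by move=> [i _ [/= Fx Fy]]; split; exists i.
Qed.

HB.instance Definition _ :=
  Measure_isSigmaFinite.Build _ _ _ area area_sigma_finite.

Ltac affine_measurable := repeat first
  [ exact: measurable_cst | exact: measurable_fst | exact: measurable_snd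
  | apply: measurable_funD | apply: measurable_funB | apply: (measurableT_comp (@oppr_measurable R _))
  | apply: measurable_funM
  | apply: (measurableT_comp measurable_fst) | apply: (measurableT_comp measurable_snd) ].

Lemma triangle_area (b : bool) (r E Y : R) : 0 <= r ->
  (area [set p : R * R | [/\ (0 <= r + sg R b * (p.2 - Y))%R,
      (3 * (p.1 / Num.sqrt 3 - E) <= 2 * r - sg R b * (p.2 - Y))%R &
      (- (3 * (p.1 / Num.sqrt 3 - E)) <= 2 * r - sg R b * (p.2 - Y))%R]] =
  (3 * Num.sqrt 3 * r ^+ 2)%:E)%E.
Proof.
move=> r0; rewrite /area product_measure_swap; last first.
  rewrite (_ : mkset _ = [set p | 0 <= r + sg R b * (p.2 - Y)] `&`
    [set p | 3 * (p.1 / Num.sqrt 3 - E) <= 2 * r - sg R b * (p.2 - Y)] `&`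
    [set p | - (3 * (p.1 / Num.sqrt 3 - E)) <= 2 * r - sg R b * (p.2 - Y)]).
    by do 2?[apply: measurableI]; apply: measurable_le_set; affine_measurable.
  by apply/seteqP; split=> p /=; [case=> *|case=> -[]].
pose lo := if b then Y - 2 * r else Y - r.
pose hi := if b then Y + r else Y + 2 * r.
pose c := 2 * Num.sqrt 3 / 3 : R.
transitivity (\int[mu]_(t in `[lo, hi])
  (c * (2 * r + sg R b * Y) + (- (c * sg R b)) * t + 0 * t ^+ 2)%:E)%E.
  rewrite [RHS]integral_mkcond; apply: eq_integral => y _.
  apply: (etrans (triangle_section b r E Y y)); rewrite patchE.
  have -> : (y \in `[lo, hi]%classic) =
      (- r <= sg R b * (y - Y)) && (sg R b * (y - Y) <= 2 * r).
    rewrite mem_setE in_itv /= /lo /hi; case: (b) => /=.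
      by apply/andP/andP => -[h1 h2]; split; lra.
    by apply/andP/andP => -[h1 h2]; split; lra.
  by case: ifP => // _; congr EFin; rewrite /c; ring.
rewrite integral_quadratic; last by rewrite /lo /hi; case: (b); lra.
by congr EFin; rewrite /lo /hi /c; case: (b) => /=; field.
Qed.

(** The slice at relative height [h] is a triangle of inradius [1 - h], and the
    integral of [3 sqrt 3 (1 - h)^2] over a height [sqrt 8] is [sqrt 3 sqrt 8]. *)
Lemma tetrahedron_volume (a b : bool) (E Y F : R) :
  volume [set u : V | [/\ 0 <= sg R a * (cf u - F),
      0 <= 1 - sg R a * (cf u - F) + sg R b * (cy u - Y),
      3 * (ce u - E) <= 2 * (1 - sg R a * (cf u - F)) - sg R b * (cy u - Y) &
      - (3 * (ce u - E)) <=
        2 * (1 - sg R a * (cf u - F)) - sg R b * (cy u - Y)]] =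
  (Num.sqrt 3 * Num.sqrt 8)%:E.
Proof.
pose r (z : R) := 1 - sg R a * (z / Num.sqrt 8 - F).
rewrite /volume; set S := (X in (_ \x _)%E X = _).
have SE : S = [set p | 0 <= sg R a * (p.2 / Num.sqrt 8 - F)] `&`
    [set p | 0 <= r p.2 + sg R b * (p.1.2 - Y)] `&`
    [set p | 3 * (p.1.1 / Num.sqrt 3 - E) <= 2 * r p.2 - sg R b * (p.1.2 - Y)] `&`
    [set p | - (3 * (p.1.1 / Num.sqrt 3 - E)) <= 2 * r p.2 - sg R b * (p.1.2 - Y)].
  rewrite /S; apply/seteqP; split=> p /=; rewrite /ce /cy /cf vec3E0 vec3E1 vec3E2.
    by case=> *.
  by case=> -[] [].
apply: (etrans (product_measure_swap area mu _)).
  rewrite SE; do 3?[apply: measurableI]; apply: measurable_le_set;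
  rewrite /r; affine_measurable.
pose lo := if a then Num.sqrt 8 * (F - 1) else Num.sqrt 8 * F.
pose hi := if a then Num.sqrt 8 * F else Num.sqrt 8 * (F + 1).
have s8 := sqrt8_gt0 R.
have lei (x c : R) : (Num.sqrt 8 * c <= x) = (c <= x / Num.sqrt 8).
  by rewrite ler_pdivlMr // mulrC.
have gei (x c : R) : (x <= Num.sqrt 8 * c) = (x / Num.sqrt 8 <= c).
  by rewrite ler_pdivrMr // mulrC.
transitivity (\int[mu]_(t in `[lo, hi])
  (3 * Num.sqrt 3 * (1 + sg R a * F) ^+ 2 +
   (- (6 * Num.sqrt 3 * (1 + sg R a * F) * sg R a / Num.sqrt 8)) * t +
   3 * Num.sqrt 3 / (Num.sqrt 8 ^+ 2) * t ^+ 2)%:E)%E.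
  rewrite [RHS]integral_mkcond; apply: eq_integral => z _; rewrite patchE.
  have -> : (z \in `[lo, hi]%classic) =
      (0 <= sg R a * (z / Num.sqrt 8 - F)) && (0 <= r z).
    rewrite mem_setE in_itv /= /lo /hi /r; case: (a) => /=; rewrite lei gei.
      by apply/andP/andP => -[h1 h2]; split; lra.
    by apply/andP/andP => -[h1 h2]; split; lra.
  case: ifPn => [/andP[h1 h2]|h].
    rewrite (_ : ysection S z = [set p : R * R | [/\ 0 <= r z + sg R b * (p.2 - Y),
      3 * (p.1 / Num.sqrt 3 - E) <= 2 * r z - sg R b * (p.2 - Y) &
      - (3 * (p.1 / Num.sqrt 3 - E)) <= 2 * r z - sg R b * (p.2 - Y)]]); last first.
      rewrite SE; apply/seteqP; split=> p /=; rewrite /ysection /= inE /=.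
        by case=> -[] [].
      by case=> *.
    apply: (etrans (triangle_area b E Y h2)); congr EFin; rewrite /r.
    by case: (a) => /=; field; exact: sqrt8_neq0.
  rewrite (_ : ysection S z = set0) ?measure0 //.
  rewrite SE; apply/seteqP; split=> p //=; rewrite /ysection /= inE /=.
  move=> -[[[h1 h2] h3] h4]; move/negP: h; apply; apply/andP; split=> //; lra.
rewrite integral_quadratic; last first.
  by rewrite /lo /hi; case: (a); rewrite ler_pM2l //; lra.
by congr EFin; rewrite /lo /hi; case: (a) => /=; field; exact: sqrt8_neq0.
Qed.

Lemma packing_volume s T : packing s T -> volume T = (Num.sqrt 3 * Num.sqrt 8)%:E.
Proof.
move=> [_ [a [b [m [k [n ->]]]]] <-].
have [E [Y [F TE]]] := act_T0P s a b m k n.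
rewrite -(tetrahedron_volume a b E Y F); congr volume.
by apply/seteqP; split=> u /TE.
Qed.

End Volume.

(** * Orbits, lattice basis and dimers *)

Section Cells.
Variable R : realType.
Local Notation V := 'rV[R]_3.
Implicit Types (u v : V) (s : R) (a b : bool) (m k n : int) (g h : V -> V).

Lemma packing_T0 s : packing s (T0 R).
Proof. by exists id; [exact: sgroup_id | exact: image_id]. Qed.

Lemma sgroup_act s a b m k n : sgroup s (act s a b m k n).
Proof. by do 5!eexists. Qed.

Lemma translationsP s v :
  translations (packing s) v <-> exists m k n, v = lat s m k n.
Proof.
split=> [[maps _ _]|[m [k [n ->]]]].
  by apply: packing_translate; apply: maps; exact: packing_T0.
apply: sgroup_leaves_invariant (sgroup_translation s m k n) _ => h S hG.
exact: packing_act.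
Qed.

Lemma act_translation s a b m k n (S : set V) :
  act s a b m k n @` S = translation (lat s m k n) @` (point_op a b @` S).
Proof. by rewrite image_comp. Qed.

Lemma latD s m k n m' k' n' :
  lat s m k n + lat s m' k' n' = lat s (m + m') (k + k') (n + n').
Proof. by apply: coordP; rewrite /lat !coordE !intrD; ring. Qed.

Definition orbit_of s (T : set V) : set (set V) :=
  [set translation v @` T | v in translations (packing s)].

Lemma translation_comp u v : translation u \o translation v = translation (v + u).
Proof. by apply/funext => w; rewrite /translation /= addrA. Qed.

Lemma orbit_of_translate s m k n T :
  orbit_of s (translation (lat s m k n) @` T) = orbit_of s T.
Proof.
apply/seteqP; split=> _ [v /translationsP[m' [k' [n' ->]]] <-].
  rewrite image_comp translation_comp latD.
  exists (lat s (m + m') (k + k') (n + n')) => //.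
  by apply/translationsP; do 3!eexists.
exists (lat s (m' - m) (k' - k) (n' - n)).
  by apply/translationsP; do 3!eexists.
rewrite image_comp translation_comp latD.
by rewrite !(addrC _ (_ - _)) !subrK.
Qed.

Lemma orbit_of_self s T : orbit_of s T T.
Proof.
exists (lat s 0 0 0); first by apply/translationsP; do 3!eexists.
rewrite (_ : translation _ = id) ?image_id //; apply/funext => u.
by apply: coordP; rewrite /translation /lat !coordE; ring.
Qed.

Lemma act_linear_part s a b m k n a' b' m' k' n' :
  act s a b m k n = act s a' b' m' k' n' -> a = a' /\ b = b'.
Proof.
move=> E; have E0 := congr1 (@^~ (pt 0 0 0)) E; have E1 := congr1 (@^~ (pt 1 1 0)) E.
move: (congr1 (@ce R) E0) (congr1 (@ce R) E1) (congr1 (@cy R) E0) (congr1 (@cy R) E1).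
rewrite /act /point_op !coordE; move: (ce (lat s m k n)) (cy (lat s m k n)).
move: (ce (lat s m' k' n')) (cy (lat s m' k' n')) => x y z t.
by case: a {E E0 E1}; case: a'; case: b; case: b' => //=; lra.
Qed.

Lemma sgroup_free2 s g h : 3 / 5 <= s <= 7 / 10 -> sgroup s g -> sgroup s h ->
  g @` T0 R = h @` T0 R -> g = h.
Proof.
move=> Js gG hG gh; have [g' [g'G gg' g'g]] := sgroup_inv gG.
have e : g' \o h = id.
  apply: (sgroup_free Js (sgroup_comp g'G hG)).
  by rewrite -image_comp -gh image_comp g'g image_id.
by rewrite -[g]/(g \o id) -e compA gg'.
Qed.

(** Two tetrahedra with different point operations are never lattice translates
    of each other, as the group acts freely. *)
Lemma orbit_of_inj s a b a' b' : 3 / 5 <= s <= 7 / 10 ->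
  orbit_of s (act s a b 0 0 0 @` T0 R) = orbit_of s (act s a' b' 0 0 0 @` T0 R) ->
  a = a' /\ b = b'.
Proof.
move=> Js E; have := orbit_of_self s (act s a b 0 0 0 @` T0 R); rewrite E.
move=> [v /translationsP[m [k [n ->]]] E'].
have tG := sgroup_comp (sgroup_translation s m k n) (sgroup_act s a' b' 0 0 0).
have := sgroup_free2 Js tG (sgroup_act s a b 0 0 0); rewrite -image_comp => /(_ E').
rewrite (_ : translation _ \o _ = act s a' b' m k n); last first.
  apply/funext => u; rewrite /translation /act /= -addrA latD !add0r //.
by move=> /act_linear_part[-> ->].
Qed.

Lemma four_orbits s : 3 / 5 <= s <= 7 / 10 ->
  per_unit_cell (packing s) (packing s) 4.
Proof.
move=> Js; rewrite /per_unit_cell.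
(* the two binary digits of [i] encode the point operation *)
pose f (i : nat) := orbit_of s (act s (odd i) (1 < i)%N 0 0 0 @` T0 R).
have -> : orbits (translations (packing s)) (packing s) = f @` `I_4.
  apply/seteqP; split=> [_ [_ [_ [a [b [m [k [n ->]]]]] <-] <-]|_ [i _ <-]].
    exists (a + b.*2)%N; first by case: a; case: b.
    rewrite act_translation -/(orbit_of s _) orbit_of_translate /f.
    rewrite act_translation orbit_of_translate.
    by case: a; case: b.
  eexists; last reflexivity.
  by exists (act s (odd i) (1 < i)%N 0 0 0) => //; exact: sgroup_act.
apply: inj_card_eq => i j; rewrite !inE /= => i4 j4 /(orbit_of_inj Js)[].
by case: i i4 => [|[|[|[|//]]]] _; case: j j4 => [|[|[|[|//]]]] _.
Qed.

(** Modulo the half-turn, which stabilizes [X0], only the identity and the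
    inversion remain. *)
Lemma act_X0_normal s a b m k n : exists n',
  act s a b m k n @` X0 R = act s b b m k n' @` X0 R.
Proof.
case: b; last by exists n; rewrite !act_X0_same.
have [n1 ->] := act_X0_inverted s a m k n; exists n1.
congr (image _ _); apply/funext => u; congr (_ + _).
by apply: coordP; rewrite /point_op /glide !coordE /=; lra.
Qed.

Lemma dimer_orbits_distinct s m k n : 3 / 5 <= s <= 7 / 10 ->
  act s true true m k n @` X0 R <> X0 R.
Proof.
move=> Js E; have : separated (X0 R) (act s true true m k n @` X0 R).
  exact: dimer_separation.
rewrite E => sep; apply: (@T0_not_separated _ (X0 R)); last by move=> u; left.
by apply: separatedW sep => // u; left.
Qed.

Lemma two_dimer_orbits s : 3 / 5 <= s <= 7 / 10 ->
  per_unit_cell (packing s) (dimers s) 2.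
Proof.
move=> Js; rewrite /per_unit_cell.
pose f (i : nat) := orbit_of s (act s (odd i) (odd i) 0 0 0 @` X0 R).
have -> : orbits (translations (packing s)) (dimers s) = f @` `I_2.
  apply/seteqP; split=> [_ [_ [_ [a [b [m [k [n ->]]]]] <-] <-]|_ [i _ <-]].
    exists (nat_of_bool b); first by case: b.
    have [n' ->] := act_X0_normal s a b m k n.
    rewrite act_translation -/(orbit_of s _) orbit_of_translate /f.
    by rewrite act_translation orbit_of_translate; case: b.
  eexists; last reflexivity.
  by exists (act s (odd i) (odd i) 0 0 0) => //; exact: sgroup_act.
have f01 : f 0%N <> f 1%N.
  move=> E; have := orbit_of_self s (X0 R).
  have -> : orbit_of s (X0 R) = f 1%N by rewrite -E /f /= act_id image_id.
  move=> [v /translationsP[m [k [n ->]]]].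
  rewrite [act s _ _ 0 0 0 @` _]act_translation image_comp image_comp.
  rewrite translation_comp latD !add0r -image_comp -act_translation.
  exact: dimer_orbits_distinct.
apply: inj_card_eq => i j; rewrite !inE /=.
by case: i => [|[|//]] _; case: j => [|[|//]] _ // /esym.
Qed.

Definition basis s : 'M[R]_3 :=
  \matrix_(i < 3) [:: lat s 1 0 0; lat s 0 1 0; lat s 0 0 1]`_i.

Lemma det3 (A : 'M[R]_3) : \det A =
  A 0 0 * (A 1 1 * A 2%:R 2%:R - A 1 2%:R * A 2%:R 1) -
  A 0 1 * (A 1 0 * A 2%:R 2%:R - A 1 2%:R * A 2%:R 0) +
  A 0 2%:R * (A 1 0 * A 2%:R 1 - A 1 1 * A 2%:R 0).
Proof.
pose f (i j : nat) : R := A (inord i) (inord j).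
have AE i j : A i j = f (val i) (val j) by rewrite /f !inord_val.
rewrite (expand_det_row _ 0) big_ord3 /cofactor.
rewrite !(expand_det_row _ 0) !big_ord_recl !big_ord0 /cofactor !det_mx11 !mxE.
by rewrite !AE /= /bump /=; ring.
Qed.

(** The parameter cancels, hence the constant density. *)
Lemma det_basis s : \det (basis s) = Num.sqrt 3 * Num.sqrt 8 * (117 / 25).
Proof. by rewrite det3 !mxE /=; field. Qed.

Lemma lattice_basisP s : lattice_basis (translations (packing s)) (basis s).
Proof.
split.
  rewrite unitmxE det_basis unitfE; apply: lt0r_neq0.
  by apply: mulr_gt0; [apply: mulr_gt0; rewrite ?sqrt3_gt0 ?sqrt8_gt0 | lra].
have comb (z : 'rV[int]_3) : map_mx intr z *m basis s =
    lat s (z 0 0) (z 0 1) (z 0 2%:R).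
  apply: row3P; rewrite mxE big_ord3 !mxE /=; ring.
apply/seteqP; split=> [v /translationsP[m [k [n ->]]]|_ [z ->]].
  exists (\row_(i < 3) [:: m; k; n]`_i); by rewrite comb !mxE.
by apply/translationsP; rewrite comb; do 3!eexists.
Qed.

Lemma packing_periodic s : 3 / 5 <= s <= 7 / 10 -> periodic (packing s).
Proof.
move=> Js; split; first by exists (basis s); exact: lattice_basisP.
by apply/finite_setP; exists 4%N; exact: four_orbits.
Qed.

Lemma packing_fraction s : 3 / 5 <= s <= 7 / 10 ->
  has_packing_fraction (packing s) (100 / 117).
Proof.
move=> Js; exists (basis s), 4%N, (Num.sqrt 3 * Num.sqrt 8); split.
- exact: lattice_basisP.
- exact: four_orbits.
- exact: packing_volume.
- have := sqrt3_gt0 R; have := sqrt8_gt0 R => h8 h3.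
  rewrite det_basis ger0_norm; last by rewrite !mulr_ge0 ?ltW.
  by field; rewrite !lt0r_neq0.
Qed.

Lemma packing_congruent s s' T T' : packing s T -> packing s' T' -> congruent T T'.
Proof.
move=> [g gG <-] [h hG <-]; have [g' [g'G gg' g'g]] := sgroup_inv gG.
exists (h \o g').
  exact: isometry_comp (sgroup_isometry hG) (sgroup_isometry g'G).
by rewrite image_comp -compA g'g.
Qed.

Lemma p0_regular : regular_vertices (p0 R).
Proof.
exists (Num.sqrt 12) => [|i j]; first by rewrite sqrtr_gt0 ltr0n.
have [->|->|->|->] := ord4P i; have [->|->|->|->] := ord4P j; rewrite ?eqxx // => _;
by rewrite /edist; congr Num.sqrt; rewrite !p0E dotE !coordE; lra.
Qed.

Lemma regular_vertices_comp g (p : 'I_4 -> V) (f : 'I_4 -> 'I_4) :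
  is_isometry g -> injective f -> regular_vertices p ->
  regular_vertices (g \o p \o f).
Proof.
move=> hg finj [l l0 hl]; exists l => // i j ij.
by rewrite /= hg hl // (inj_eq finj).
Qed.

Lemma packing_regular s T : packing s T -> regular_tetrahedron T.
Proof.
move=> [g gG <-]; exists (g \o p0 R \o id).
  exact: regular_vertices_comp (sgroup_isometry gG) _ p0_regular.
exact: isometry_conv4 (sgroup_isometry gG).
Qed.

Lemma conv4_involution (p : 'I_4 -> V) (f : 'I_4 -> 'I_4) :
  involutive f -> conv4 (p \o f) = conv4 p.
Proof.
move=> fK; have sub (q : 'I_4 -> V) : conv4 (q \o f) `<=` conv4 q.
  move=> _ [w [w0 w1 ->]]; exists (w \o f); split=> [i||]; first exact: w0.
    by rewrite -w1 [RHS](reindex_inj (inv_inj fK)).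
  rewrite (reindex_inj (inv_inj fK)); apply: eq_bigr => i _.
  by rewrite /= fK.
apply/seteqP; split; first exact: sub.
have {1}-> : p = (p \o f) \o f by apply/funext => i; rewrite /= fK.
exact: sub.
Qed.

(** The half-turn fixes the vertex [p0 2] of the common face and exchanges
    [p0 0] with [p0 1]. *)
Definition swap01 (i : 'I_4) : 'I_4 :=
  if i == 0 then 1 else if i == 1 then 0 else i.

Lemma swap01K : involutive swap01.
Proof. by move=> i; have [->|->|->|->] := ord4P i. Qed.

Lemma dimers_halves s X : dimers s X -> exists T1 T2,
  [/\ packing s T1, packing s T2, dimer_halves T1 T2 & X = T1 `|` T2].
Proof.
move=> [g gG <-].
have point_opE : point_op true false = act s true false 0 0 0.
  apply/funext => u; apply: coordP; rewrite /act /lat !coordE; ring.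
have rG : sgroup s (point_op true false) by rewrite point_opE; exact: sgroup_act.
pose r := point_op true false : V -> V.
have grG := sgroup_comp gG rG.
have P1 : packing s (g @` T0 R) by exists g.
have P2 : packing s ((g \o r) @` T0 R) by exists (g \o r).
exists (g @` T0 R), ((g \o r) @` T0 R); split=> //; last first.
  by rewrite image_setU image_comp.
exists (g \o p0 R \o id), ((g \o r) \o p0 R \o swap01); split.
- split.
  + exact: regular_vertices_comp (sgroup_isometry gG) _ p0_regular.
  + exact: regular_vertices_comp (sgroup_isometry grG) (inv_inj swap01K) p0_regular.
  + exact: isometry_conv4 (sgroup_isometry gG).
  + by rewrite (conv4_involution _ swap01K); apply: isometry_conv4 (sgroup_isometry grG).
- exact: packing_congruent P1 P2.
- move=> i; have [->|->|->|->] := ord4P i => // _; congr g; rewrite /=.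
  + by apply: coordP; rewrite /r /point_op /glide !p0E !coordE /=; lra.
  + by apply: coordP; rewrite /r /point_op /glide !p0E !coordE /=; lra.
  + by apply: coordP; rewrite /r /point_op /glide !p0E !coordE /=; lra.
- have maxE : ord_max = 3%:R :> 'I_4 by exact: val_inj.
  rewrite maxE.
  exists (g (p0 R 3%:R) - g (r (p0 R 3%:R))).
  case: gG => [a [b [m [k [n ->]]]]]; rewrite /=.
  split=> [i||].
  + have [->|->|->|->] := ord4P i => // _;
      rewrite dotE /r /act /point_op /glide !p0E !coordE; case: (a); case: (b) => /=; lra.
  + rewrite dotE /r /act /point_op /glide !p0E !coordE; case: (a); case: (b) => /=; lra.
  + rewrite dotE /r /act /point_op /glide !p0E !coordE; case: (a); case: (b) => /=; lra.
Qed.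

Lemma dimers_partition s : 3 / 5 <= s <= 7 / 10 ->
  dimer_partition (packing s) (dimers s).
Proof.
move=> Js; split=> [X|_ [g gG <-]]; first exact: dimers_halves.
exists (g @` X0 R); split.
  split; first by exists g.
  by move=> _ [u uT <-]; exists u => //; left.
move=> _ [[h hG <-] sub]; have [g' [g'G gg' g'g]] := sgroup_inv gG.
have /(dimer_unique Js (sgroup_comp g'G hG)) e : T0 R `<=` (g' \o h) @` X0 R.
  rewrite -image_comp => u uT; have [v vX gv] := sub (g u) (ex_intro2 _ _ u uT erefl).
  by exists (g u); [exists v | by have := congr1 (@^~ u) g'g].
by rewrite -[in LHS]e image_comp compA gg'.
Qed.

Lemma dimers_invariant s v : translations (packing s) v ->
  leaves_invariant (translation v) (dimers s).
Proof.
move=> /translationsP[m [k [n ->]]].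
apply: sgroup_leaves_invariant (sgroup_translation s m k n) _ => h S hG.
exact: dimers_act.
Qed.

End Cells.

(** * The space group C2/c *)

Section SpaceGroup.
Variable R : realType.
Local Notation V := 'rV[R]_3.
Implicit Types (u v : V) (s : R) (a b : bool) (m k n : int) (g h : V -> V).

(** The conventional centred cell: the vector of the half-turn axis comes second
    and [lat s 1 0 0] is half the sum of the first two rows. *)
Definition cell s : 'M[R]_3 :=
  \matrix_(i < 3) [:: lat s 2 (-1) 0; lat s 0 1 0; lat s 0 0 1]`_i.

Lemma det_cell s : \det (cell s) = Num.sqrt 3 * Num.sqrt 8 * (234 / 25).
Proof. by rewrite det3 !mxE /=; field. Qed.

Lemma det_cell_gt0 s : 0 < \det (cell s).
Proof.
rewrite det_cell.
by apply: mulr_gt0; [apply: mulr_gt0; rewrite ?sqrt3_gt0 ?sqrt8_gt0 | lra].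
Qed.

Lemma cell_unit s : cell s \in unitmx.
Proof. by rewrite unitmxE unitfE lt0r_neq0 ?det_cell_gt0. Qed.

Definition of_cell s : V -> V := affine_map (cell s) 0.
Definition to_cell s : V -> V := affine_inv (cell s) 0.

Lemma of_cellK s : cancel (of_cell s) (to_cell s).
Proof.
move=> u; rewrite /of_cell /to_cell /affine_map /affine_inv addr0 subr0.
by rewrite mulmxK ?cell_unit.
Qed.

Lemma to_cellK s : cancel (to_cell s) (of_cell s).
Proof.
move=> u; rewrite /of_cell /to_cell /affine_map /affine_inv addr0 subr0.
by rewrite mulmxKV ?cell_unit.
Qed.

Lemma of_cellE s u :
  of_cell s u = u 0 0 *: lat s 2 (-1) 0 + u 0 1 *: lat s 0 1 0 + u 0 2%:R *: lat s 0 0 1.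
Proof.
by apply: row3P; rewrite /of_cell /affine_map addr0 !mxE big_ord3 !mxE.
Qed.

(** Conjugation by [of_cell s] takes [h] to [g]. *)
Definition in_cell s h g := forall u, of_cell s (h u) = g (of_cell s u).

Lemma in_cell_conj s h g : in_cell s h g -> of_cell s \o h \o to_cell s = g.
Proof. by move=> hg; apply/funext => u; rewrite /= hg to_cellK. Qed.

Lemma generators_in_cell s h : C2c_generators h ->
  exists2 g, sgroup s g & in_cell s h g.
Proof.
have solve (h' : V -> V) a b m k n :
    (forall u, of_cell s (h' u) = act s a b m k n (of_cell s u)) ->
    exists2 g, sgroup s g & in_cell s h' g.
  by exists (act s a b m k n); first exact: sgroup_act.
case=> [[[[[->|->]|->]|->]|->]|->].
- by apply: (solve _ false false 2 (-1) 0) => u; apply: coordP;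
    rewrite !of_cellE /act /point_op /lat /glide !coordE !mxE /=; lra.
- by apply: (solve _ false false 0 1 0) => u; apply: coordP;
    rewrite !of_cellE /act /point_op /lat /glide !coordE !mxE /=; lra.
- by apply: (solve _ false false 0 0 1) => u; apply: coordP;
    rewrite !of_cellE /act /point_op /lat /glide !coordE !mxE /=; lra.
- by apply: (solve _ false false 1 0 0) => u; apply: coordP;
    rewrite !of_cellE /act /point_op /lat /glide !coordE !mxE /=; lra.
- by apply: (solve _ true false 0 0 0) => u; apply: coordP;
    rewrite !of_cellE /act /point_op /lat /glide !coordE !mxE /=; lra.
- by apply: (solve _ true true 0 0 0) => u; apply: coordP;
    rewrite !of_cellE /act /point_op /lat /glide !coordE !mxE /=; lra.
Qed.


(** Conjugates of generated elements lie in the group, because those of the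
    generators do. *)
Lemma generated_in_cell s h : generated (@C2c_generators R) h ->
  exists2 g, sgroup s g & in_cell s h g.
Proof.
elim=> {h} [|h|h1 h2 _ [g1 gG1 e1] _ [g2 gG2 e2]|h h' _ [g gG e] hK h'K].
- by exists id; first exact: sgroup_id.
- exact: generators_in_cell.
- exists (g1 \o g2); first exact: sgroup_comp.
  by move=> u; rewrite /= e1 e2.
- have [g' [g'G gg' g'g]] := sgroup_inv gG; exists g' => // u.
  by rewrite -[LHS]/(id _) -g'g /= -e h'K.
Qed.

Definition from_cell s g := generated (@C2c_generators R) (to_cell s \o g \o of_cell s).

Lemma from_cell_comp s g h : from_cell s g -> from_cell s h -> from_cell s (g \o h).
Proof.
rewrite /from_cell => hg hh.
suff -> : to_cell s \o (g \o h) \o of_cell s =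
   (to_cell s \o g \o of_cell s) \o (to_cell s \o h \o of_cell s) by exact: gen_comp.
by apply/funext => u; rewrite /= to_cellK.
Qed.

Lemma from_cell_inv s g h : cancel g h -> cancel h g -> from_cell s g -> from_cell s h.
Proof.
by move=> gh hg /gen_inv; apply=> u; rewrite /= to_cellK ?gh ?hg of_cellK.
Qed.

Lemma from_cell_generator s h g : C2c_generators h -> in_cell s h g -> from_cell s g.
Proof.
move=> hgen hg; rewrite /from_cell (_ : _ \o _ = h); first exact: gen_mem.
by apply/funext => u; rewrite /= -hg of_cellK.
Qed.

Lemma from_cell_translation_int s (v : int -> V) :
  (forall i j, v (i + j) = v i + v j) -> from_cell s (translation (v 1)) ->
  forall i, from_cell s (translation (v i)).
Proof.
move=> vD v1.
have v0 : v 0 = 0 by apply: (@addrI _ (v 0)); rewrite -vD !addr0.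
have pos (i : nat) : from_cell s (translation (v i%:Z)).
  elim: i => [|i IH].
    rewrite v0 /from_cell (_ : _ \o _ = id); first exact: gen_id.
    by apply/funext => u; rewrite /= /translation addr0 of_cellK.
  by rewrite -addn1 PoszD vD -translation_comp; apply: from_cell_comp.
case=> i; first exact: pos.
rewrite NegzE; apply: (@from_cell_inv _ (translation (v i.+1%:Z))) (pos _) => u.
  by rewrite /translation -addrA -vD subrr v0 addr0.
by rewrite /translation -addrA -vD addNr v0 addr0.
Qed.

Lemma from_cell_lat s m k n : from_cell s (translation (lat s m k n)).
Proof.
have gen v w : C2c_generators (translation v) -> of_cell s v = w ->
    from_cell s (translation w).
  move=> vgen <-; apply: from_cell_generator vgen _ => u.
  by rewrite /translation !of_cellE !mxE; apply: coordP; rewrite !coordE; ring.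
have -> : lat s m k n = lat s 0 0 n + lat s 0 k 0 + lat s m 0 0.
  by rewrite !latD !add0r !addr0.
rewrite -!translation_comp; apply: from_cell_comp; last apply: from_cell_comp.
- apply: (from_cell_translation_int (v := fun i => lat s i 0 0)) => [i j|].
    by rewrite latD !addr0.
  apply: (@gen (vec3 2^-1 2^-1 0)); first by left; left; right.
  by apply: coordP; rewrite of_cellE /lat !coordE !mxE /=; lra.
- apply: (from_cell_translation_int (v := fun i => lat s 0 i 0)) => [i j|].
    by rewrite latD !addr0.
  apply: (@gen (vec3 0 1 0)); first by left; left; left; left; right.
  by apply: coordP; rewrite of_cellE /lat !coordE !mxE /=; lra.
- apply: (from_cell_translation_int (v := fun i => lat s 0 0 i)) => [i j|].
    by rewrite latD !addr0.
  apply: (@gen (vec3 0 0 1)); first by left; left; left; right.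
  by apply: coordP; rewrite of_cellE /lat !coordE !mxE /=; lra.
Qed.

(** Conversely every element is a product of a lattice translation with the
    half-turn, the inversion or both, all of which come from generators. *)
Lemma sgroup_from_cell s g : sgroup s g -> from_cell s g.
Proof.
move=> [a [b [m [k [n ->]]]]].
have rot : from_cell s (point_op true false).
  apply: (@from_cell_generator _
    (fun u => vec3 (- u 0 0) (u 0 1) (- u 0 2%:R + 2^-1))); first by left; right.
  move=> u; apply: coordP; rewrite !of_cellE /point_op /lat /glide !coordE !mxE;
  by rewrite /=; lra.
have inv : from_cell s (point_op true true).
  apply: (@from_cell_generator _ (fun u => - u)); first by right.
  move=> u; apply: coordP; rewrite !of_cellE /point_op /lat /glide !coordE !mxE;
  by rewrite /=; lra.
have actE g' : act s a b m k n = translation (lat s m k n) \o g' ->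
    from_cell s g' -> from_cell s (act s a b m k n).
  by move=> -> g'G; apply: from_cell_comp g'G; apply: from_cell_lat.
case: a b actE => -[] actE.
- exact: actE erefl inv.
- exact: actE erefl rot.
- apply: (actE (point_op true false \o point_op true true)).
    apply/funext => u; congr (_ + _); apply: coordP;
    by rewrite /point_op /glide !coordE /=; lra.
  exact: from_cell_comp.
- apply: (actE id) => [|].
    apply/funext => u; congr (_ + _); apply: coordP;
    by rewrite /point_op /glide !coordE /=; lra.
  rewrite /from_cell (_ : _ \o _ = id); first exact: gen_id.
  by apply/funext => u; rewrite /= of_cellK.
Qed.

Lemma sgroup_space_group s : space_group_C2c (sgroup s).
Proof.
split; first exact: sgroup_isometry.
exists (cell s), 0; split; first exact: det_cell_gt0.
apply/seteqP; split=> [g gG|_ [h hgen <-]].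
  exists (to_cell s \o g \o of_cell s); first exact: sgroup_from_cell.
  by apply/funext => u; rewrite /= -/(of_cell s _) -/(to_cell s _) !to_cellK.
have [g gG e] := generated_in_cell s hgen.
by rewrite -/(of_cell s) -/(to_cell s) (in_cell_conj e).
Qed.

Lemma symmetries_packing s : 3 / 5 <= s <= 7 / 10 -> symmetries (packing s) = sgroup s.
Proof.
move=> Js; apply/seteqP; split=> [g [giso [maps _ _]]|g gG].
  by have [_] := rigidity Js Js giso maps.
split; first exact: sgroup_isometry gG.
by apply: sgroup_leaves_invariant gG _ => h S hG; exact: packing_act.
Qed.

Lemma sgroup_transitive s : transitive_on (sgroup s) (packing s).
Proof.
move=> _ _ [g gG <-] [h hG <-]; have [g' [g'G gg' g'g]] := sgroup_inv gG.
exists (h \o g'); first exact: sgroup_comp.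
by rewrite image_comp -compA g'g.
Qed.

End SpaceGroup.

(** * The family *)

Theorem theorem1 (R : realType) :
  exists (J : set R) (P : R -> set (set 'rV[R]_3)),
    one_parameter_family J P /\
    forall x : R, J x ->
      [/\ periodic (P x) /\ has_packing_fraction (P x) (100 / 117),
          (exists D : set (set 'rV[R]_3),
             [/\ dimer_partition (P x) D,
                 forall v, translations (P x) v ->
                   leaves_invariant (translation v) D &
                 per_unit_cell (P x) D 2]) /\
          per_unit_cell (P x) (P x) 4 &
          space_group_C2c (symmetries (P x)) /\
          transitive_on (symmetries (P x)) (P x)].
Proof.
exists [set s | 3 / 5 <= s <= 7 / 10], (@packing R); split.
  split.
  - split; last by exists (3 / 5), (7 / 10); split => /=; lra.
    by move=> x y /= /andP[hx _] /andP[_ hy] z /andP[xz zy]; apply/andP; split; lra.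
  - move=> s Js; split=> [T|T T'|T T']; first exact: packing_regular.
      exact: packing_congruent.
    exact: packing_disjoint.
  - by move=> s s' T T' _ _; exact: packing_congruent.
  - move=> s s' Js Js' ss' [g giso gP]; apply: ss'.
    have [] // := rigidity Js Js' giso.
    by move=> T PT; rewrite -gP; exists T.
move=> s Js; rewrite symmetries_packing //; split.
- by split; [exact: packing_periodic | exact: packing_fraction].
- split; last exact: four_orbits.
  exists (dimers s); split; first exact: dimers_partition.
    exact: dimers_invariant.
  exact: two_dimer_orbits.
- by split; [exact: sgroup_space_group | exact: sgroup_transitive].
Qed.
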